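(* Consider any regular network with $k\ge2$ nodes (with $\sqrt k$ an integer), cell size $s>0$ and placement-flexibility parameter $0\le\beta<1$, destination set $\{2,\dots,k\}$, and channel gains given by the path loss model with constants $\alpha>2$, $r_0>0$, $\bar g>0$. Then $$\frac{{E_b}_{\rm flood}}{{E_b}_{\min}}\le c_1,$$ where $$c_1\le\max\left\{\frac{2^{\frac{3\alpha}2+4}\,\zeta(\alpha-1)}{(1-\beta)^\alpha},\ (2r_0)^\alpha\bar g,\ \frac{2^{\frac{3\alpha}2+3}\,r_0^\alpha}{(1-\beta)^{\alpha+2}}\left(\bar g+\frac{2^{\alpha-2}}{(\alpha-2)r_0^\alpha}\right)\bigl(1+4(1-\beta)^2\bigr)\right\}$$ and $\zeta(\cdot)$ is the Riemann zeta function. That is: there is a sequence of flooding schemes whose parameters do not depend on the positions of the nodes within their windows (they may depend on $k,s,\beta,N_0$ and the path loss model), each reliably delivering the message to all nodes, whose infimum ${E_b}_{\rm flood}$ of total energies per bit is at most $c_1{E_b}_{\min}$, with $c_1$ at most the maximum of the three quantities $\frac{2^{\frac{3\alpha}2+4}\,\zeta(\alpha-1)}{(1-\beta)^\alpha}$, $(2r_0)^\alpha\bar g$ and $\frac{2^{\frac{3\alpha}2+3}\,r_0^\alpha}{(1-\beta)^{\alpha+2}}\left(\bar g+\frac{2^{\alpha-2}}{(\alpha-2)r_0^\alpha}\right)\bigl(1+4(1-\beta)^2\bigr)$ (independently of $k$ and $s$).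
   Context: Regular network. The network area is the square $[0,\sqrt k\,s]^2$ divided into $k$ square cells of side $s$, where $\sqrt k$ is an integer larger than $1$; $C(x,y)$, $x,y\in\{0,\dots,\sqrt k-1\}$, is the cell with lower left corner $(xs,ys)$. Each cell has a centered square window of side $\beta s$: the window of $C(x,y)$ has opposite corners $(xs+\frac{(1-\beta)s}2,\,ys+\frac{(1-\beta)s}2)$ and $(xs+\frac{(1+\beta)s}2,\,ys+\frac{(1+\beta)s}2)$. Each cell contains exactly one node, located arbitrarily within its window. The source node $1$ lies in the window of the origin cell $C(0,0)$. Channel model. There are $k$ nodes. At discrete time $t$ node $i$ transmits $x_{i,t}\in\mathbb C$ and node $j$ receives $y_{j,t}=\sum_{i=1}^k h_{ij,t}x_{i,t}+z_{j,t}$. The noises $z_{j,t}$ are $\mathcal{CN}(0,N_0)$, independent over $j$ and $t$. The fading coefficients $h_{ij,t}$ ($i\ne j$) are circularly symmetric complex random variables, i.i.d. over time; $h_{ij,t}$ and $h_{lm,t}$ are independent for $(i,j)\neq(l,m)$; $h_{ii,t}=0$. Message, noise and fading are mutually independent. Channel state information is not available at the transmitters: $x_{i,t}$ is independent of $(h_{i1,t},\dots,h_{ik,t})$. Path loss model. $\mathbb E[|h_{ij}|^2]=g(r_{ij})$, with $r_{ij}$ the Euclidean distance between nodes $i$ and $j$, where $g:\mathbb R_+\to\mathbb R_+$ is monotonically decreasing, $g(r)=r^{-\alpha}$ for all $r\ge r_0$, and $g(0)\le\bar g$. Minimum energy per bit (destination set $\mathcal R=\{2,\dots,k\}$). A code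 of block length $n$ with $M$ equiprobable messages consists of a source codeword $x_1^{(n)}(m)\in\mathbb C^n$, causal relay functions $x_{i,t}=x_{i,t}(y_{i,1},\dots,y_{i,t-1})$ for $i\ge2$, and decoders $\hat m_i(y_{i,1},\dots,y_{i,n})$ for $i\in\mathcal R$; its error probability is the probability (averaged over messages) that some $i\in\mathcal R$ has $\hat m_i\ne m$; its expected total energy is $\mathbb E[\sum_i\sum_t|x_{i,t}|^2]$. An $(n,M,E_{\rm total},\epsilon)$ code has expected total energy at most $E_{\rm total}$ and error probability at most $\epsilon$. $E_b\ge0$ is $\epsilon$-achievable if for every $\delta>0$ there is $E_0$ such that for every $E_{\rm total}\ge E_0$ there is an $(n,M,E_{\rm total},\epsilon)$ code with $E_{\rm total}/\log_2M<E_b+\delta$; it is achievable if $\epsilon$-achievable for all $0<\epsilon<1$; ${E_b}_{\min}$ is the infimum of achievable values. Flooding. In $\mathtt{FLOOD}({E_b}_1,{E_b}_2)$ time is divided into slots $1,\dots,T$ ($T$ a design parameter). The source transmits only in slot $1$, with energy per bit ${E_b}_1$. In each slot $t=2,\dots,T$, a non-source node that was able to decode for the first time in slot $t-1$ retransmits the same message with energy per bit ${E_b}_2$; otherwise it is silent. Thus each node transmits at most once. There is no bandwidth constraint and nodes use mutually orthogonal wide frequency bands, so that a node accumulates received energy over all transmissions: its received energy per bit by the end of a slot is the sum, over the (correct) transmissions made so far by other nodes, of channel gain times transmitted energy per bit. A node is able to decode reliably (with vanishing error probability) by the end of a slot once its accumulated received energy per bit strictly exceeds $N_0\log_e2$.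 The total energy per bit ${E_b}_{\rm total}$ of the scheme is the sum of the energies per bit of all transmissions, so ${E_b}_{\rm total}\le {E_b}_1+(k-1){E_b}_2$. For a sequence of flooding schemes reaching all nodes, ${E_b}_{\rm flood}$ denotes the infimum of ${E_b}_{\rm total}$ over the sequence. *)

(* Defs.v *)
From HB Require Import structures.
From mathcomp Require Import all_boot all_order all_algebra.
From mathcomp Require Import all_classical all_reals all_analysis.
From mathcomp Require Import complex.

Set Implicit Arguments.
Unset Strict Implicit.
Unset Printing Implicit Defensive.
Import Order.TTheory GRing.Theory Num.Theory.
Import numFieldNormedType.Exports.
Local Open Scope classical_set_scope.
Local Open Scope ring_scope.

(* The complex numbers carry the Borel sigma-algebra of the plane, transported
   along z |-> (Re z, Im z). *)
Section complex_measurable.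
Variable R : realType.

Definition complex_coords (z : R[i]) : R * R := (complex.Re z, complex.Im z).

Definition complex_measurable : set (set R[i]) :=
  preimage_set_system setT complex_coords measurable.

Let sigma_algebra_complex : sigma_algebra setT complex_measurable.
Proof.
apply: sigma_algebra_preimage.
by split => //; [move=> A mA; rewrite setTD; exact: measurableC
                |exact: bigcupT_measurable].
Qed.

Let complex_measurable0 : complex_measurable set0.
Proof. by case: sigma_algebra_complex. Qed.

Let complex_measurableC A : complex_measurable A -> complex_measurable (~` A).
Proof. by case: sigma_algebra_complex => _ h _ /h; rewrite setTD. Qed.

Let complex_measurable_bigcup (F : (set R[i])^nat) :
  (forall n, complex_measurable (F n)) -> complex_measurable (\bigcup_n F n).
Proof. by case: sigma_algebra_complex => _ _; exact. Qed.

HB.instance Definition _ := isPointed.Build R[i] 0.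
HB.instance Definition _ := @isMeasurable.Build default_measure_display R[i]
  complex_measurable complex_measurable0 complex_measurableC
  complex_measurable_bigcup.

End complex_measurable.

Definition csqnorm (R : realType) (z : R[i]) : R :=
  complex.Re z ^+ 2 + complex.Im z ^+ 2.

Definition cis (R : realType) (theta : R) : R[i] := Complex (cos theta) (sin theta).

Definition log2 (R : realType) (x : R) : R := ln x / ln 2.

Definition zeta (R : realType) (a : R) : R := limn (series (riemannR a)).

Definition dist (R : realType) (p q : R * R) : R :=
  Num.sqrt ((p.1 - q.1) ^+ 2 + (p.2 - q.2) ^+ 2).

Definition in_window (R : realType) (s beta : R) (x y : nat) (p : R * R) : Prop :=
  (x%:R * s + (1 - beta) * s / 2 <= p.1 <= x%:R * s + (1 + beta) * s / 2) /\
  (y%:R * s + (1 - beta) * s / 2 <= p.2 <= y%:R * s + (1 + beta) * s / 2).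

Record regular_network (R : realType) (k q : nat) (s beta : R) := RegularNetwork {
  cell : 'I_k -> 'I_q * 'I_q;
  cell_bij : bijective cell;
  pos : 'I_k -> R * R;
  pos_in_window : forall i, in_window s beta (cell i).1 (cell i).2 (pos i);
  source : 'I_k;
  source_in_origin : (cell source).1 = 0%N :> nat /\ (cell source).2 = 0%N :> nat
}.

Definition path_loss (R : realType) (alpha r0 gbar : R) (g : R -> R) : Prop :=
  [/\ forall r, 0 <= r -> 0 <= g r,
      forall r r', 0 <= r -> r <= r' -> g r' <= g r,
      forall r, r0 <= r -> g r = r `^ (- alpha)
    & g 0 <= gbar].

Definition gain (R : realType) (k q : nat) (s beta : R) (g : R -> R)
    (net : regular_network k q s beta) (i j : 'I_k) : R :=
  g (dist (pos net i) (pos net j)).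

Definition mutually_independent d (T : measurableType d) (R : realType)
    (P : probability T R) (I : choiceType) (X : I -> T -> R[i]) : Prop :=
  forall (J : seq I) (B : I -> set R[i]), uniq J ->
    (forall a, measurable (B a)) ->
    P (\bigcap_(a in [set` J]) X a @^-1` B a)
    = (\prod_(a <- J) P (X a @^-1` B a))%E.

(* CN(0, N0): independent real and imaginary parts, each N(0, N0 / 2); the
   second argument of [normal_prob] is the standard deviation. *)
Definition complex_normal d (T : measurableType d) (R : realType)
    (P : probability T R) (N0 : R) (Z : T -> R[i]) : Prop :=
  forall A B : set R, measurable A -> measurable B ->
    P [set w | A (complex.Re (Z w)) /\ B (complex.Im (Z w))]
    = (normal_prob 0 (Num.sqrt (N0 / 2)) A * normal_prob 0 (Num.sqrt (N0 / 2)) B)%E.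

Definition circularly_symmetric d (T : measurableType d) (R : realType)
    (P : probability T R) (X : T -> R[i]) : Prop :=
  forall (theta : R) (B : set R[i]), measurable B ->
    P [set w | B (cis theta * X w)] = P [set w | B (X w)].

(* Times are numbered from 0. [fading i j t] is the coefficient from i to j. *)
Record channel (R : realType) (V : finType) (gain : V -> V -> R) (N0 : R)
    d (T : measurableType d) (P : probability T R) := Channel {
  fading : V -> V -> nat -> T -> R[i];
  noise : V -> nat -> T -> R[i];
  fading_measurable : forall i j t, measurable_fun setT (fading i j t);
  noise_measurable : forall j t, measurable_fun setT (noise j t);
  noise_normal : forall j t, complex_normal P N0 (noise j t);
  fading_self : forall i t w, fading i i t w = 0;
  fading_circular : forall i j t, i != j -> circularly_symmetric P (fading i j t);
  fading_stationary : forall i j t t' (B : set R[i]), i != j -> measurable B ->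
    P (fading i j t @^-1` B) = P (fading i j t' @^-1` B);
  fading_moment : forall i j t, i != j ->
    ('E_P[fun w => csqnorm (fading i j t w)] = (gain i j)%:E)%E;
  fading_noise_independent : mutually_independent P
    (fun a : (V * V * nat) + (V * nat) =>
       match a with
       | inl (i, j, t) => fading i j t
       | inr (j, t) => noise j t
       end)
}.

(* At time t a relay only sees its t earlier outputs. The components
   [relay src] and [decoder src] at the source are never used. *)
Record code (R : realType) (V : finType) (n M : nat) := Code {
  codeword : 'I_M -> n.-tuple R[i];
  relay : V -> forall t : nat, t.-tuple R[i] -> R[i];
  decoder : V -> n.-tuple R[i] -> 'I_M;
  relay_measurable : forall i t, measurable_fun setT (@relay i t);
  decoder_measurable : forall i m, measurable [set y | decoder i y = m]
}.

Section transmission.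
Context (R : realType) (V : finType) (src : V) (G : V -> V -> R) (N0 : R).
Context d (T : measurableType d) (P : probability T R) (ch : channel G N0 P).

Section run.
Context (n M : nat) (c : code R V n M) (m : 'I_M) (w : T).

Definition input (i : V) (t : nat) (past : t.-tuple R[i]) : R[i] :=
  if i == src then (codeword c m)`_t else relay c i past.

(* [outputs t j] lists the first t channel outputs at node j. *)
Fixpoint outputs (t : nat) : V -> t.-tuple R[i] :=
  match t return V -> t.-tuple R[i] with
  | 0%N => fun=> [tuple]
  | u.+1 => fun j => [tuple of rcons (outputs u j)
      (\sum_(i : V) fading ch i j u w * input i (outputs u i) + noise ch j u w)]
  end.

Definition sent_energy : R :=
  \sum_(i : V) \sum_(t < n) csqnorm (input i (outputs t i)).

End run.

(* Equiprobable messages, independent of noise and fading: expectation and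
   probability are averaged over the M messages. *)
Definition expected_energy n M (c : code R V n M) : \bar R :=
  (((M%:R : R)^-1)%:E * \sum_(m < M) 'E_P[sent_energy c m])%E.

Definition error_probability n M (c : code R V n M) : \bar R :=
  (((M%:R : R)^-1)%:E * \sum_(m < M)
     P [set w | exists2 i, i != src & decoder c i (outputs c m w n i) <> m])%E.

Definition is_code n M (E eps : R) (c : code R V n M) : Prop :=
  (expected_energy c <= E%:E)%E /\ (error_probability c <= eps%:E)%E.

(* M >= 2, so that the energy per bit E / log2 M is meaningful. *)
Definition eps_achievable (eps Eb : R) : Prop :=
  forall delta, 0 < delta -> exists E0 : R, forall E, E0 <= E ->
    exists n M : nat, [/\ (1 < M)%N,
      exists c : code R V n M, is_code E eps c & E / log2 (M%:R : R) < Eb + delta].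

Definition achievable (Eb : R) : Prop :=
  0 <= Eb /\ forall eps, 0 < eps < 1 -> eps_achievable eps Eb.

Definition Eb_min : \bar R := ereal_inf [set Eb%:E | Eb in achievable].

End transmission.

Record flood_scheme (R : realType) := FloodScheme {
  Eb1 : R;
  Eb2 : R;
  slots : nat;
  Eb1_ge0 : 0 <= Eb1;
  Eb2_ge0 : 0 <= Eb2
}.

(* Whether a node decodes is governed by its accumulated received energy per bit
   and the threshold N0 ln 2. State at the end of a slot: the nodes knowing the message, those that learned
   it during that slot (hence transmit in the next one), the accumulated received
   energies per bit, and the total energy per bit spent. *)
Record flood_state (R : realType) (V : finType) := FloodState {
  decoded : {set V};
  fresh : {set V};
  received : V -> R;
  spent : R
}.

Section flooding.
Context (R : realType) (V : finType) (src : V) (G : V -> V -> R) (N0 : R).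
Variable F : flood_scheme R.

Definition send_energy (i : V) : R := if i == src then Eb1 F else Eb2 F.

Definition flood_init : flood_state R V :=
  FloodState [set src]%SET [set src]%SET (fun=> 0) 0.

Definition flood_slot (S : flood_state R V) : flood_state R V :=
  let rcv j := received S j + \sum_(i in fresh S | i != j) G i j * send_energy i in
  let dec := (decoded S :|: [set j | N0 * ln 2 < rcv j])%SET in
  FloodState dec (dec :\: decoded S)%SET rcv
    (spent S + \sum_(i in fresh S) send_energy i).

Definition flood_run : flood_state R V := iter (slots F) flood_slot flood_init.

Definition reaches_all : Prop := decoded flood_run = [set: V]%SET.

Definition flood_energy : R := spent flood_run.

End flooding.

Definition Eb_flood (R : realType) (V : finType) (src : V) (G : V -> V -> R)
    (N0 : R) (F : nat -> flood_scheme R) : \bar R :=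
  ereal_inf (range (fun l => (flood_energy src G N0 (F l))%:E)).

(* Main.v *)
(* Converse. Against the law of pure noise, one received sample s + Z with
   Z ~ CN(0, N0) costs at most |s|^2 / N0 nats: for every bounded measurable
   f >= 1, E ln f (s + Z) <= ln (E f (Z)) + |s|^2 / N0. As the noise at time t is
   independent of the past and of the fading at time t, this can be iterated along
   the transmission, giving E ln f (Y^n) <= ln (E f (Z^n)) + sum_t E |S_t|^2 / N0
   at node j. Taking f = M on the decoding region of m and f = 1 elsewhere, and
   summing over m, yields (1 - eps) ln M <= 1 + (received energy at j) / N0.
   The fading coefficients are independent and circularly symmetric, so the
   received energy at j is the sum over i of g_ij times the energy sent by i.
   Summing over a set D of nodes j, Eb_min >= |D| N0 ln 2 / max_i (sum_{j in D} g_ij).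
   With D the set of all nodes but the source, the sum of gains is controlled by the
   8 m cells at Chebyshev distance m; with D a single node it is at most gbar.

   Flooding. Each node either lies in the b x b block of cells at the origin, or has
   a b x b block of nodes closer to the source and within range D. If the source
   sends with energy e / g(D) and all other nodes with energy e / (b^2 g(D)), then
   a node receives at least e from the source or from such a block.
   With u = (1 - beta) s, take b = 1 and
   D = 2 sqrt(2) s when u >= r0; b = floor(r0 / u) and
   D = 2 sqrt(2) r0 / (1 - beta) when u < r0 and (k - 1) s^2 >= r0^2; in the
   remaining case one transmission of range D = 2 r0 reaches the whole network. *)

Require Import Defs.
From HB Require Import structures.
From mathcomp Require Import all_boot all_order all_algebra.
From mathcomp Require Import all_classical all_reals all_analysis.
From mathcomp Require Import measurable_realfun.
From mathcomp Require Import complex ring lra zify.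
Import Order.TTheory GRing.Theory Num.Theory.
Import numFieldNormedType.Exports.
Local Open Scope classical_set_scope.
Local Open Scope ring_scope.
Set Implicit Arguments.
Unset Strict Implicit.
Unset Printing Implicit Defensive.

(** * Gaussian measures *)

Section gaussian.
Context {R : realType}.
Notation mu := (@lebesgue_measure R).
Notation RM := (measurableTypeR R).
Local Open Scope ereal_scope.

Lemma lebesgue_measure_translate (s : R) A : measurable A ->
  pushforward mu (+%R s : RM -> RM) A = mu A.
Proof.
have mphi : measurable_fun setT (+%R s : RM -> RM).
  by apply: measurable_funD.
move=> mA; apply/esym/lebesgue_measure_unique => //= _ [[a b]] _ <-.
have -> : pushforward mu (+%R s : RM -> RM) `]a, b]
    = mu `](a - s)%R, (b - s)%R].
  congr (lebesgue_measure _); apply/seteqP; split => x /=;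
    by rewrite !in_itv/= ltrBlDl lerBrDl.
rewrite !lebesgue_measure_itv/= !lte_fin ltrD2r.
by case: ifP => // _; rewrite -!EFinD; congr EFin; ring.
Qed.

Lemma ge0_integral_translate (s : R) (f : RM -> \bar R) :
  measurable_fun setT f -> (forall x, 0 <= f x) ->
  \int[mu]_x f (s + x)%R = \int[mu]_x f x.
Proof.
move=> mf f0.
have mphi : measurable_fun setT (+%R s : RM -> RM).
  by apply: measurable_funD.
transitivity (\int[pushforward mu (+%R s : RM -> RM)]_y f y).
  by rewrite ge0_integral_pushforward.
by apply: eq_measure_integral => //= A mA _; exact: lebesgue_measure_translate.
Qed.

(** The change of variables uses the Radon-Nikodym derivative of the Gaussian law, which agrees
    almost everywhere with [normal_pdf]: both have the same integral over every measurable set. *)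
Lemma ge0_integral_normal_prob (m s : R) (f : RM -> \bar R) :
  measurable_fun setT f -> (forall x, 0 <= f x) ->
  \int[normal_prob m s]_x f x = \int[mu]_x (f x * (normal_pdf m s x)%:E).
Proof.
move=> mf f0.
have dom := @normal_prob_dominates R m s.
rewrite -(Radon_Nikodym_SigmaFinite.change_of_variables dom f0)//.
apply: ae_eq_integral => //.
- apply: emeasurable_funM => //.
  exact: measurable_int (Radon_Nikodym_SigmaFinite.f_integrable dom).
- apply: emeasurable_funM => //.
  by apply/measurable_EFinP; exact: measurable_normal_pdf.
- apply: ae_eqe_mul2l.
  apply: integral_ae_eq => //.
  + exact: Radon_Nikodym_SigmaFinite.f_integrable.
  + by apply/measurable_EFinP; exact: measurable_normal_pdf.
  + by move=> E ET mE; rewrite -Radon_Nikodym_SigmaFinite.f_integral.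
Qed.

Lemma normr_le_expRD (x : R) : (`|x| <= expR x + expR (- x))%R.
Proof.
have h1 := expR_ge1Dx x; have h2 := expR_ge1Dx (- x).
have h3 := expR_gt0 x; have h4 := expR_gt0 (- x).
by rewrite ler_norml; apply/andP; split; lra.
Qed.

(* Density of N(- t, s^2) with respect to N(0, s^2) *)
Definition normal_tilt (s t x : R) : R :=
  expR (- (2 * x * t + t ^+ 2) / (2 * s ^+ 2)).

Lemma normal_tilt_gt0 s t x : (0 < normal_tilt s t x)%R.
Proof. exact: expR_gt0. Qed.

Lemma measurable_normal_tilt s t : measurable_fun (setT : set RM) (normal_tilt s t).
Proof.
apply: measurableT_comp => //; apply: measurable_funM => //.
apply: measurableT_comp => //; apply: measurable_funD => //.
by do 2 apply: measurable_funM => //.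
Qed.

Lemma normal_tiltE s t x : s != 0%R ->
  (normal_tilt s t x * normal_pdf 0 s x = normal_pdf 0 s (t + x))%R.
Proof.
move=> s0; rewrite !normal_pdfE// /normal_tilt /normal_fun mulrCA -expRD.
by congr (_ * expR _)%R; rewrite !subr0 -mulr_natr; field.
Qed.

(** Cameron-Martin shift: the weight turns the density at [x] into the density at [t + x], and
    Lebesgue measure is invariant under translation. *)
Lemma ge0_integral_normal_shift (s t : R) (f : RM -> \bar R) : s != 0%R ->
  measurable_fun setT f -> (forall x, 0 <= f x) ->
  \int[normal_prob 0 s]_x (f (t + x)%R * (normal_tilt s t x)%:E)
  = \int[normal_prob 0 s]_x f x.
Proof.
move=> s0 mf f0.
have mt : measurable_fun setT (fun x : RM => f (t + x)%R).
  apply: (measurableT_comp mf).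
  by apply: measurable_funD.
rewrite !ge0_integral_normal_prob//; last 2 first.
- apply: emeasurable_funM => //.
  by apply/measurable_EFinP; exact: measurable_normal_tilt.
- by move=> x; rewrite mule_ge0// lee_fin ltW// normal_tilt_gt0.
rewrite -[RHS](ge0_integral_translate t); last 2 first.
- apply: emeasurable_funM => //.
  by apply/measurable_EFinP; exact: measurable_normal_pdf.
- by move=> x; rewrite mule_ge0// lee_fin normal_pdf_ge0.
by apply: eq_integral => x _; rewrite -muleA -EFinM normal_tiltE.
Qed.

Lemma ge0_integral_normal_opp (s : R) (f : RM -> \bar R) : s != 0%R ->
  measurable_fun setT f -> (forall x, 0 <= f x) ->
  \int[normal_prob 0 s]_x f (- x)%R = \int[normal_prob 0 s]_x f x.
Proof.
move=> s0 mf f0.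
have mphi : measurable_fun setT (-%R : RM -> RM) by exact: oppr_measurable.
rewrite !ge0_integral_normal_prob//; last by exact: measurableT_comp.
pose h (y : RM) := f y * (normal_pdf 0 s y)%:E.
have mh : measurable_fun setT h.
  apply: emeasurable_funM => //.
  by apply/measurable_EFinP; exact: measurable_normal_pdf.
have h0 x : 0 <= h x by rewrite mule_ge0// lee_fin normal_pdf_ge0.
transitivity (\int[pushforward mu (-%R : RM -> RM)]_y h y).
  rewrite (ge0_integral_pushforward mphi mu measurableT mh); last by [].
  apply: eq_integral => x _ /=; congr (_ * _%:E).
  by rewrite !normal_pdfE// /normal_fun !subr0 sqrrN.
by apply: eq_measure_integral => //= A mA _; exact: lebesgue_measureN.
Qed.

(** Up to the factor [c], the tilts by [s ^+ 2] and [- s ^+ 2] are [expR (- x)] and [expR x], whose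
    sum dominates the absolute value of [x]; each tilt has integral 1. *)
Lemma integrable_normal_id (s : R) : s != 0%R ->
  (normal_prob 0 s).-integrable setT (EFin : RM -> \bar R).
Proof.
move=> s0.
have s20 : (0 < s ^+ 2)%R by rewrite exprn_even_gt0.
have tilt1 t : \int[normal_prob 0 s]_x (normal_tilt s t x)%:E = 1.
  have := @ge0_integral_normal_shift s t (cst 1) s0.
  rewrite /= => /(_ (measurable_cst _) (fun=> lee01)).
  under eq_integral do rewrite mul1e.
  by move=> ->; rewrite integral_cst//= mul1e probability_setT.
pose c := (expR ((s ^+ 2) / 2))%R.
pose h (x : RM) := (c * (normal_tilt s (s ^+ 2) x + normal_tilt s (- s ^+ 2) x))%R.
apply: (@le_integrable _ _ _ _ _ _ _ (EFin \o h)) => //.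
- move=> x _ /=; rewrite lee_fin.
  have hE : h x = (expR x + expR (- x))%R.
    by rewrite /h /c mulrDr /normal_tilt -!expRD addrC; congr (expR _ + expR _)%R; field.
  by rewrite hE [leRHS]ger0_norm ?addr_ge0 ?expR_ge0// normr_le_expRD.
- have mh : measurable_fun setT (EFin \o h).
    apply/measurable_EFinP; apply: measurable_funM => //.
    by apply: measurable_funD; exact: measurable_normal_tilt.
  apply/integrableP; split => //.
  under eq_integral => x _ do rewrite /= ger0_norm ?mulr_ge0 ?addr_ge0 ?expR_ge0// EFinM EFinD.
  rewrite ge0_integralZl//; last 3 first.
  + apply: emeasurable_funD; apply/measurable_EFinP; exact: measurable_normal_tilt.
  + by move=> x _; rewrite adde_ge0 ?lee_fin ?expR_ge0.
  + by rewrite lee_fin expR_ge0.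
  rewrite ge0_integralD//; last 4 first.
  + by move=> x _; rewrite lee_fin expR_ge0.
  + by apply/measurable_EFinP; exact: measurable_normal_tilt.
  + by move=> x _; rewrite lee_fin expR_ge0.
  + by apply/measurable_EFinP; exact: measurable_normal_tilt.
  by rewrite !tilt1 -EFinD -EFinM ltry.
Qed.

(** By symmetry of the law, the positive and negative parts of the identity have the same integral,
    which is finite. *)
Lemma integral_normal_id (s : R) : s != 0%R ->
  \int[normal_prob 0 s]_x (x%:E) = 0.
Proof.
move=> s0; rewrite integralE.
rewrite -(@ge0_integral_normal_opp s (EFin : RM -> \bar R)^\+)//; last first.
  exact: measurable_funepos.
have -> : (fun x : RM => (EFin : RM -> \bar R)^\+ (- x)%R)
    = (EFin : RM -> \bar R)^\-.
  by apply/funext => x; rewrite funeposE funenegE.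
rewrite subee//.
by have /integrable_fin_num := integrable_funeneg measurableT (integrable_normal_id s0); apply.
Qed.

End gaussian.

Section bounded.
Context d (T : measurableType d) (R : realType) (P : probability T R).

Lemma probability_bounded_integrable (f : T -> R) (a b : R) :
  measurable_fun setT f -> (forall x, a <= f x <= b) ->
  P.-integrable setT (EFin \o f).
Proof.
move=> mf ab; apply: measurable_bounded_integrable => //.
  by rewrite (@le_lt_trans _ _ 1%E)// ?probability_le1// ltry.
exists (Num.max `|a| `|b|); split; first by rewrite num_real.
move=> M hM x _; apply: le_trans (ltW hM); rewrite le_max.
have /andP[afx fxb] := ab x.
have [f0|f0] := leP 0 (f x).
  by rewrite (ger0_norm f0) (le_trans fxb (ler_norm b)) orbT.
by rewrite (ltr0_norm f0) -normrN (le_trans _ (ler_norm (- a)))// lerN2.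
Qed.

Lemma probability_EFin_Rintegral (f : T -> R) (a b : R) :
  measurable_fun setT f -> (forall x, a <= f x <= b) ->
  (\int[P]_x (f x)%:E = (\int[P]_x f x)%:E)%E.
Proof.
move=> mf ab; rewrite /Rintegral fineK//.
have /integrable_fin_num := probability_bounded_integrable mf ab.
exact.
Qed.

Lemma probability_Rintegral_bound (f : T -> R) (a b : R) :
  measurable_fun setT f -> (forall x, a <= f x <= b) ->
  a <= \int[P]_x f x <= b.
Proof.
move=> mf ab.
have cE (c : R) : \int[P]_x c = c.
  by rewrite Rintegral_cst//= probability_setT mulr1.
have intc (c : R) : P.-integrable setT (EFin \o (fun=> c)).
  by apply: (@probability_bounded_integrable _ c c) => // x; rewrite lexx.
have intf := probability_bounded_integrable mf ab.
apply/andP; split.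
  rewrite -[leLHS]cE; apply: le_Rintegral => // x _.
  by case/andP: (ab x).
rewrite -[leRHS]cE; apply: le_Rintegral => // x _.
by case/andP: (ab x).
Qed.

End bounded.

(** * Gibbs inequality for one real Gaussian sample *)

Section gibbs.
Context {R : realType}.
Notation RM := (measurableTypeR R).

(** Tangent line of the concave function [ln] at [c]. *)
Lemma ln_bound_le (u c : R) : 0 < u -> 0 < c -> ln u <= u / c - 1 + ln c.
Proof.
move=> u0 c0; have uc0 : 0 < u / c by rewrite divr_gt0.
rewrite -lerBlDr -ln_div ?posrE//.
have := @le_ln1Dx R (u / c - 1); rewrite [1 + _]addrC subrK; apply.
by rewrite ltrBrDl subrr.
Qed.

(** The last term is the relative entropy of N(t, s^2) with respect to N(0, s^2). Let [g] be the
    shifted [f] times the tilt, of mean [c]. The tangent of [ln] at [c] bounds [ln (g x)]; the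
    exponent of the tilt is affine in [x], and [x] has mean 0. *)
Lemma normal_gibbs (s t : R) (f : RM -> R) (C : R) : s != 0 ->
  measurable_fun setT f -> (forall x, 1 <= f x <= C) ->
  \int[normal_prob 0 s]_x ln (f (t + x))
  <= ln (\int[normal_prob 0 s]_x f x) + t ^+ 2 / (2 * s ^+ 2).
Proof.
move=> s0 mf f1C; set N := normal_prob 0 s; set c := \int[N]_x f x.
have s20 : 0 < s ^+ 2 by rewrite exprn_even_gt0.
have f_gt0 x : 0 < f x by case/andP: (f1C x) => /(lt_le_trans ltr01).
have /andP[c1 cC] : 1 <= c <= C by exact: probability_Rintegral_bound.
have c0 : 0 < c by exact: lt_le_trans ltr01 c1.
have mft : measurable_fun setT (fun x : RM => f (t + x)).
  by apply: (measurableT_comp mf); apply: measurable_funD.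
have mlf : measurable_fun setT (fun x : RM => ln (f (t + x))).
  by apply: measurableT_comp mft; exact: measurable_ln.
have intl : N.-integrable setT (EFin \o (fun x : RM => ln (f (t + x)))).
  apply: (@probability_bounded_integrable _ _ _ N _ 0 (ln C)) => // x.
  have /andP[h1 h2] := f1C (t + x).
  by rewrite ln_ge0// ler_ln// posrE ?(lt_le_trans ltr01 h1)// (lt_le_trans _ h2).
pose g (x : RM) := f (t + x) * normal_tilt s t x.
have mg : measurable_fun setT g.
  by apply: measurable_funM => //; exact: measurable_normal_tilt.
have gE : (\int[N]_x (g x)%:E = c%:E)%E.
  rewrite /c -(@probability_EFin_Rintegral _ _ _ N f 1 C)//.
  have mEf : measurable_fun setT (EFin \o f) by exact/measurable_EFinP.
  have Ef0 x : (0 <= (EFin \o f) x)%E by rewrite lee_fin ltW.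
  by rewrite -(ge0_integral_normal_shift t s0 mEf Ef0).
have intg : N.-integrable setT (EFin \o g).
  apply/integrableP; split; first exact/measurable_EFinP.
  rewrite (_ : (fun x => _) = (fun x => (g x)%:E)) ?gE ?ltry//.
  apply/funext => x /=; rewrite ger0_norm// mulr_ge0 ?ltW//.
  exact: normal_tilt_gt0.
have gR : \int[N]_x g x = c by rewrite /Rintegral gE.
pose k := ln c - 1 + t ^+ 2 / (2 * s ^+ 2).
have intk : N.-integrable setT (EFin \o (fun _ : RM => k)).
  by apply: (@probability_bounded_integrable _ _ _ N _ k k) => // x; rewrite lexx.
have intid := integrable_normal_id s0.
have idE : \int[N]_x x = 0 by rewrite /Rintegral integral_normal_id.
pose h1 (x : RM) := c^-1 * g x.
pose h2 (x : RM) := t / s ^+ 2 * x.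
have inth1 : N.-integrable setT (EFin \o h1).
  exact: (integrableZl measurableT c^-1 intg).
have inth2 : N.-integrable setT (EFin \o h2).
  exact: (integrableZl measurableT (t / s ^+ 2) intid).
have inth12 : N.-integrable setT (EFin \o (h1 \+ h2)).
  exact: (integrableD measurableT inth1 inth2).
(* The right side is the mean of a pointwise bound: [h1] has mean 1 and [h2] has mean 0. *)
have -> : ln c + t ^+ 2 / (2 * s ^+ 2) = \int[N]_x ((h1 \+ h2) x + k).
  rewrite RintegralD// RintegralD// !RintegralZl// idE gR Rintegral_cst//=.
  rewrite probability_setT /k mulVf ?gt_eqF// mulr0 mulr1; ring.
apply: le_Rintegral => //.
  exact: (integrableD measurableT inth12 intk).
move=> x _.
have g0 : 0 < g x by rewrite mulr_gt0// normal_tilt_gt0.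
have : ln (g x) <= g x / c - 1 + ln c by exact: ln_bound_le.
rewrite /g lnM ?posrE ?normal_tilt_gt0// /normal_tilt expRK -/(g x) => gx.
rewrite /h1 /h2 /k /=.
have E : t / s ^+ 2 * x + t ^+ 2 / (2 * s ^+ 2)
    = - (- (2 * x * t + t ^+ 2) / (2 * s ^+ 2)) by field.
rewrite [c^-1 * _]mulrC; move: gx E.
move: (- _ / _) (t ^+ 2 / _) (t / _ * x) (g x / c) (ln _) (ln c).
by move=> e1 e2 e3 u v w; lra.
Qed.

End gibbs.

(** * Independence of complex random variables *)

Section complex_measurability.
Context {R : realType}.
Notation RM := (measurableTypeR R).

Lemma measurable_complex_coords :
  measurable_fun setT (@complex_coords R : R[i] -> RM * RM).
Proof. by move=> _ B mB; exists B. Qed.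

Lemma measurable_Re : measurable_fun setT (@complex.Re R : R[i] -> RM).
Proof.
exact: (measurableT_comp (@measurable_fst _ _ RM RM) measurable_complex_coords).
Qed.

Lemma measurable_Im : measurable_fun setT (@complex.Im R : R[i] -> RM).
Proof.
exact: (measurableT_comp (@measurable_snd _ _ RM RM) measurable_complex_coords).
Qed.

Context d (T : measurableType d).

Lemma measurable_complexP (f : T -> R[i]) :
  measurable_fun setT (fun x => complex.Re (f x) : RM) ->
  measurable_fun setT (fun x => complex.Im (f x) : RM) ->
  measurable_fun setT f.
Proof.
move=> mRe mIm _ _ [B mB <-]; rewrite !setTI.
have := measurable_fun_pair mRe mIm.
by move=> /(_ measurableT _ mB); rewrite setTI.
Qed.

Lemma measurable_complexD (f g : T -> R[i]) : measurable_fun setT f ->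
  measurable_fun setT g -> measurable_fun setT (fun x => f x + g x).
Proof.
move=> mf mg; apply: measurable_complexP.
  rewrite (_ : (fun x => _) = (fun x => complex.Re (f x) + complex.Re (g x))).
    by apply: measurable_funD; exact: (measurableT_comp measurable_Re).
  by apply/funext => x; case: (f x) (g x) => ? ? [].
rewrite (_ : (fun x => _) = (fun x => complex.Im (f x) + complex.Im (g x))).
  by apply: measurable_funD; exact: (measurableT_comp measurable_Im).
by apply/funext => x; case: (f x) (g x) => ? ? [].
Qed.

Lemma measurable_complexM (f g : T -> R[i]) : measurable_fun setT f ->
  measurable_fun setT g -> measurable_fun setT (fun x => f x * g x).
Proof.
move=> mf mg.
have mRf := measurableT_comp measurable_Re mf.
have mIf := measurableT_comp measurable_Im mf.
have mRg := measurableT_comp measurable_Re mg.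
have mIg := measurableT_comp measurable_Im mg.
apply: measurable_complexP.
  rewrite (_ : (fun x => _) = (fun x => complex.Re (f x) * complex.Re (g x)
      - complex.Im (f x) * complex.Im (g x))).
    by apply: measurable_funB; apply: measurable_funM.
  by apply/funext => x; case: (f x) (g x) => ? ? [].
rewrite (_ : (fun x => _) = (fun x => complex.Re (f x) * complex.Im (g x)
    + complex.Im (f x) * complex.Re (g x))).
  by apply: measurable_funD; apply: measurable_funM.
by apply/funext => x; case: (f x) (g x) => ? ? [].
Qed.

Lemma measurable_complex_sum (I : eqType) (s : seq I) (f : I -> T -> R[i]) :
  (forall i, i \in s -> measurable_fun setT (f i)) ->
  measurable_fun setT (fun x => \sum_(i <- s) f i x).
Proof.
elim: s => [_|i s IH mf].
  by rewrite (_ : (fun _ => _) = cst 0)//; apply/funext => x; rewrite big_nil.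
rewrite (_ : (fun _ => _) = (fun x => f i x + \sum_(i <- s) f i x)).
  apply: measurable_complexD; first by apply: mf; rewrite mem_head.
  by apply: IH => l ls; apply: mf; rewrite inE ls orbT.
by apply/funext => x; rewrite big_cons.
Qed.

Lemma measurable_csqnorm (f : T -> R[i]) : measurable_fun setT f ->
  measurable_fun setT (fun x => csqnorm (f x) : RM).
Proof.
move=> mf; apply: measurable_funD; apply: measurable_funX.
  exact: (measurableT_comp measurable_Re mf).
exact: (measurableT_comp measurable_Im mf).
Qed.

End complex_measurability.

Section csqnorm_theory.
Context {R : realType}.
Implicit Types x y : R[i].

Lemma csqnorm_ge0 x : 0 <= csqnorm x.
Proof. by rewrite addr_ge0 ?sqr_ge0. Qed.

Lemma csqnormM x y : csqnorm (x * y) = csqnorm x * csqnorm y.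
Proof. by case: x y => a b [c e]; rewrite /csqnorm /=; ring. Qed.

Lemma csqnorm_parallelogram x y :
  csqnorm (x + y) + csqnorm (- x + y) = 2 * csqnorm x + 2 * csqnorm y.
Proof. by case: x y => a b [c e]; rewrite /csqnorm /=; ring. Qed.

Lemma csqnorm0 : csqnorm (0 : R[i]) = 0.
Proof. by rewrite /csqnorm /= expr0n addr0. Qed.

Lemma cis_pi : cis pi = -1 :> R[i].
Proof. by apply/eqP; rewrite eq_complex /= cospi sinpi oppr0 !eqxx. Qed.

End csqnorm_theory.

Section independence.
Context d (T : measurableType d) (R : realType) (P : probability T R).
Notation RM := (measurableTypeR R).
Local Open Scope ereal_scope.

Definition independent_pair d1 d2 (A : measurableType d1) (B : measurableType d2)
    (U : T -> A) (V : T -> B) : Prop :=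
  forall C D, measurable C -> measurable D ->
    P (U @^-1` C `&` V @^-1` D) = P (U @^-1` C) * P (V @^-1` D).

(** The law of the pair is the product of the two laws, since they agree on rectangles; Tonelli then
    integrates [V] with [U] frozen. *)
Lemma independent_pair_integral d1 d2 (A : measurableType d1)
    (B : measurableType d2) (U : T -> A) (V : T -> B) (f : A * B -> \bar R) :
  measurable_fun setT U -> measurable_fun setT V -> independent_pair U V ->
  measurable_fun setT f -> (forall x, 0 <= f x) ->
  \int[P]_w f (U w, V w) = \int[P]_w \int[P]_v f (U w, V v).
Proof.
move=> mU mV indep mf f0.
pose U' : {mfun T >-> A} := HB.pack U (isMeasurableFun.Build _ _ _ _ _ mU).
pose V' : {mfun T >-> B} := HB.pack V (isMeasurableFun.Build _ _ _ _ _ mV).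
have mUV := measurable_fun_pair mU mV.
transitivity (\int[pushforward P (fun w => (U w, V w))]_z f z).
  by rewrite ge0_integral_pushforward.
transitivity (\int[distribution P U' \x distribution P V']_z f z).
  apply: eq_measure_integral => C mC _; apply/esym.
  by apply: product_measure_unique.
rewrite fubini_tonelli1//= /fubini_F.
rewrite ge0_integral_pushforward//=; last 2 first.
- exact: measurable_fun_fubini_tonelli_F.
- by move=> x _; exact: integral_ge0.
apply: eq_integral => w _ /=.
rewrite ge0_integral_pushforward//=.
exact: measurableT_comp.
Qed.

Lemma complex_normal_integral (N0 : R) (Z : T -> R[i]) (f : R[i] -> \bar R) :
  measurable_fun setT Z -> complex_normal P N0 Z ->
  measurable_fun setT f -> (forall x, 0 <= f x) ->
  let N := normal_prob 0 (Num.sqrt (N0 / 2)) in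
  \int[P]_w f (Z w) = \int[N]_x \int[N]_y f (Complex x y).
Proof.
move=> mZ nZ mf f0 N.
pose h (p : RM * RM) := f (Complex p.1 p.2).
have mh : measurable_fun setT h.
  apply: (measurableT_comp mf); apply: measurable_complexP.
    exact: measurable_fst.
  exact: measurable_snd.
have h0 p : 0 <= h p by exact: f0.
have mc : measurable_fun setT (fun w => complex_coords (Z w) : RM * RM).
  exact: (measurableT_comp measurable_complex_coords mZ).
transitivity (\int[P]_w h (complex_coords (Z w))).
  by apply: eq_integral => w _; rewrite /h /complex_coords; case: (Z w).
transitivity (\int[pushforward P (fun w => complex_coords (Z w) : RM * RM)]_z h z).
  by rewrite ge0_integral_pushforward.
transitivity (\int[N \x N]_z h z).
  apply: eq_measure_integral => C mC _; apply/esym.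
  by apply: product_measure_unique => // C1 C2 mC1 mC2; exact: nZ.
by rewrite fubini_tonelli1.
Qed.

(** Negation is the rotation by the angle [pi]. *)
Lemma circular_integralN (X : T -> R[i]) (f : R[i] -> \bar R) :
  measurable_fun setT X -> circularly_symmetric P X ->
  measurable_fun setT f -> (forall x, 0 <= f x) ->
  \int[P]_w f (- X w)%R = \int[P]_w f (X w).
Proof.
move=> mX cX mf f0.
have mN : measurable_fun setT (fun w => - X w)%R.
  rewrite (_ : (fun w => _) = (fun w => cis pi * X w)%R).
    by apply: measurable_complexM.
  by apply/funext => w; rewrite cis_pi mulN1r.
transitivity (\int[pushforward P (fun w => - X w)%R]_z f z).
  by rewrite ge0_integral_pushforward.
transitivity (\int[pushforward P X]_z f z).
  apply: eq_measure_integral => C mC _.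
  rewrite /pushforward -[RHS](cX pi)//; congr (P _).
  by apply/seteqP; split => w /=; rewrite cis_pi mulN1r.
by rewrite ge0_integral_pushforward.
Qed.

End independence.

(** * Gibbs inequality for one complex Gaussian sample *)

Section complex_gibbs.
Context d (T : measurableType d) (R : realType) (P : probability T R).
Notation RM := (measurableTypeR R).

Lemma measurable_Rintegral_param d1 d2 (A : measurableType d1)
    (B : measurableType d2) (Q : probability B R) (k : A * B -> R) :
  measurable_fun setT k -> (forall x, 0 <= k x) ->
  measurable_fun setT (fun x => \int[Q]_y k (x, y)).
Proof.
move=> mk k0; rewrite /Rintegral.
apply: measurableT_comp; first exact: fine_measurable.
apply: (@measurable_fun_fubini_tonelli_F _ _ _ _ _ Q (EFin \o k)).
  exact/measurable_EFinP.
by move=> x; rewrite /= lee_fin.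
Qed.

Lemma complex_normal_Rintegral (N0 : R) (Z : T -> R[i]) (f : R[i] -> R) (C : R) :
  measurable_fun setT Z -> complex_normal P N0 Z ->
  measurable_fun setT f -> (forall x, 0 <= f x <= C) ->
  let N := normal_prob 0 (Num.sqrt (N0 / 2)) in
  \int[P]_w f (Z w) = \int[N]_x \int[N]_y f (Complex x y).
Proof.
move=> mZ nZ mf f0C N.
have f0 x : 0 <= f x by case/andP: (f0C x).
have mEf : measurable_fun setT (EFin \o f) by exact/measurable_EFinP.
have Ef0 x : (0 <= (EFin \o f) x)%E by rewrite lee_fin.
rewrite /Rintegral; congr fine.
have := complex_normal_integral mZ nZ mEf Ef0; rewrite /= => ->.
apply: eq_integral => x _ /=; rewrite fineK//.
have mc : measurable_fun setT (fun y : RM => f (Complex x y)).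
  apply: (measurableT_comp mf); apply: measurable_complexP.
    exact: measurable_cst.
  exact: measurable_id.
have := @probability_bounded_integrable _ _ _ N _ 0 C mc (fun y => f0C _).
by move=> /(integrable_fin_num measurableT).
Qed.

(** [normal_gibbs] is used twice: in the imaginary part with the real part frozen, then in the real
    part for the partial mean [H], which again lies between 1 and [C]. Each coordinate has variance
    [N0 / 2], so the costs are [b ^+ 2 / N0] and [a ^+ 2 / N0]. *)
Lemma complex_gibbs (N0 : R) (Z : T -> R[i]) (s : R[i]) (h : R[i] -> R) (C : R) :
  0 < N0 -> measurable_fun setT Z -> complex_normal P N0 Z ->
  measurable_fun setT h -> (forall x, 1 <= h x <= C) ->
  \int[P]_w ln (h (s + Z w)) <= ln (\int[P]_w h (Z w)) + csqnorm s / N0.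
Proof.
move=> N00 mZ nZ mh h1C.
set sg := Num.sqrt (N0 / 2); set N := normal_prob 0 sg.
have sg2 : 2 * sg ^+ 2 = N0 by rewrite sqr_sqrtr ?divr_ge0 ?ltW// mulrC divfK.
have sg0 : sg != 0.
  by apply/eqP => sg0; move: N00; rewrite -sg2 sg0 expr0n mulr0 ltxx.
have h0 x : 0 < h x by case/andP: (h1C x) => /(lt_le_trans ltr01).
have hlnC x : 0 <= ln (h x) <= ln C.
  have /andP[h1 h2] := h1C x; rewrite ln_ge0// ler_ln// posrE//.
  exact: lt_le_trans h2.
have h0C x : 0 <= h x <= C by case/andP: (h1C x) => _ ->; rewrite ltW.
pose k (p : RM * RM) := h (Complex p.1 p.2).
have mk : measurable_fun setT k.
  apply: (measurableT_comp mh); apply: measurable_complexP.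
    exact: measurable_fst.
  exact: measurable_snd.
have mky x : measurable_fun setT (fun y : RM => k (x, y)).
  exact: (measurableT_comp mk (pair1_measurable x)).
have mlk : measurable_fun setT (fun p => ln (k p)).
  exact: (measurableT_comp (@measurable_ln R) mk).
case: s => a b.
pose shift (p : RM * RM) : RM * RM := (a + p.1, b + p.2).
have mshift : measurable_fun setT shift.
  by apply: measurable_fun_pair; apply: measurable_funD.
have mlks : measurable_fun setT (fun p => ln (k (shift p))).
  exact: (measurableT_comp mlk mshift).
rewrite (@complex_normal_Rintegral N0 Z (fun z => ln (h (Complex a b + z))) (ln C))//; last first.
  apply: measurableT_comp => //; apply: measurableT_comp => //.
  by apply: measurable_complexD => //.
rewrite (complex_normal_Rintegral mZ nZ mh h0C) -/sg -/N.
pose H (x : RM) := \int[N]_y k (x, y).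
have mH : measurable_fun setT H.
  by apply: measurable_Rintegral_param => // p; exact/ltW/h0.
have H1C x : 1 <= H x <= C by apply: probability_Rintegral_bound => // y; exact: h1C.
have H0 x : 0 < H x by case/andP: (H1C x) => /(lt_le_trans ltr01).
have lnHC x : 0 <= ln (H x) <= ln C.
  have /andP[h1 h2] := H1C x; rewrite ln_ge0// ler_ln// posrE//.
  exact: lt_le_trans h2.
have mlHa : measurable_fun setT (fun x : RM => ln (H (a + x))).
  apply: (measurableT_comp (@measurable_ln R)); apply: (measurableT_comp mH).
  exact: measurable_funD.
have step x : \int[N]_y ln (k (shift (x, y))) <= ln (H (a + x)) + b ^+ 2 / N0.
  rewrite -sg2; apply: (@normal_gibbs R sg b (fun y => k (a + x, y)) C) => // y.
  exact: h1C.
have int1 : N.-integrable setT (EFin \o (fun x => \int[N]_y ln (k (shift (x, y))))).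
  apply: (@probability_bounded_integrable _ _ _ N _ 0 (ln C)) => [|x].
    apply: (@measurable_Rintegral_param _ _ _ _ N (fun p => ln (k (shift p)))) => // p.
    by case/andP: (hlnC (Complex (shift p).1 (shift p).2)).
  apply: probability_Rintegral_bound => [|y]; last exact: hlnC.
  exact: (measurableT_comp mlks (pair1_measurable x)).
have int2 : N.-integrable setT (EFin \o (fun x => ln (H (a + x)))).
  exact: (@probability_bounded_integrable _ _ _ N _ 0 (ln C)).
have int3 : N.-integrable setT (EFin \o (fun _ : RM => b ^+ 2 / N0)).
  by apply: (@probability_bounded_integrable _ _ _ N _ (b ^+ 2 / N0) (b ^+ 2 / N0)) => // x; rewrite lexx.
apply: (@le_trans _ _ (\int[N]_x (ln (H (a + x)) + b ^+ 2 / N0))).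
  apply: le_Rintegral => // [|x _]; last exact: step.
  exact: (integrableD measurableT int2 int3).
rewrite RintegralD// Rintegral_cst//= probability_setT mulr1.
rewrite /csqnorm /= mulrDl addrA lerD2r -sg2.
exact: (@normal_gibbs R sg a H C).
Qed.

End complex_gibbs.

(** * Sigma-algebras generated by subfamilies of independent variables *)

Section cylinders.
Context d (T : measurableType d) (R : realType) (P : probability T R).
Context (I : choiceType) (X : I -> T -> R[i]).
Hypothesis mX : forall a, measurable_fun setT (X a).
Hypothesis indepX : mutually_independent P X.

Definition cylinder (J : set I) : set (set T) :=
  [set A | exists s (B : I -> set R[i]), [/\ uniq s, [set` s] `<=` J,
     (forall a, measurable (B a)) & A = \bigcap_(a in [set` s]) X a @^-1` B a]].

(** [T] with the coarser sigma-algebra generated by the [X a] with [a] in [J]. Measurability of a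
    map out of this type expresses that the map depends on these variables only. *)
Definition cylinderType (J : set I) := g_sigma_algebraType (cylinder J).

Lemma measurable_preimageX a B : measurable B -> measurable (X a @^-1` B).
Proof. by move=> mB; rewrite -[X in measurable X]setTI; exact: mX. Qed.

Lemma cylinder_measurable J A : cylinder J A -> measurable A.
Proof.
move=> [s [B [us _ mB ->]]].
apply: fin_bigcap_measurable; first exact: finite_seq.
by move=> a _; exact: measurable_preimageX.
Qed.

Lemma sigma_cylinder_measurable J (A : set T) : <<s cylinder J >> A -> measurable A.
Proof.
apply: smallest_sub; first exact: sigma_algebra_measurable.
exact: cylinder_measurable.
Qed.

Lemma cylinderI J : setI_closed (cylinder J).
Proof.
move=> _ _ [s1 [B1 [us1 s1J mB1 ->]]] [s2 [B2 [us2 s2J mB2 ->]]].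
pose B a := (if a \in s1 then B1 a else setT) `&` (if a \in s2 then B2 a else setT).
exists (undup (s1 ++ s2)), B; split; first exact: undup_uniq.
- by move=> a /=; rewrite mem_undup mem_cat => /orP[/s1J|/s2J].
- by move=> a; apply: measurableI; case: ifP.
- apply/seteqP; split => w /=.
    by move=> [h1 h2] a /= _; split; case: ifP => // ?; [exact: h1|exact: h2].
  move=> h; split => a /= as1.
    have [] := h a; first by rewrite /= mem_undup mem_cat as1.
    by rewrite as1.
  have [] := h a; first by rewrite /= mem_undup mem_cat as1 orbT.
  by rewrite as1.
Qed.

Lemma cylinderType_measurable J d' (A : measurableType d') (U : T -> A) :
  measurable_fun setT (U : cylinderType J -> A) -> measurable_fun setT U.
Proof.
by move=> mU _ B mB; apply: (@sigma_cylinder_measurable J); exact: mU.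
Qed.

Lemma measurable_cylinderX (J : set I) a : J a ->
  measurable_fun setT (X a : cylinderType J -> R[i]).
Proof.
move=> Ja _ B mB; rewrite setTI; apply: sub_sigma_algebra.
exists [:: a], (fun=> B); split => //.
  by move=> b /=; rewrite inE => /eqP ->.
apply/seteqP; split => w /=.
  by move=> h b /=; rewrite inE => /eqP ->.
by move=> /(_ a); apply; rewrite /= inE.
Qed.

(** Dynkin's pi-lambda argument: cylinders are closed under intersection, and the events that are
    independent of [X a] lying in [D] are stable under complement and disjoint countable union. *)
Lemma cylinder_independent (J : set I) a d' (A : measurableType d')
    (U : T -> A) : ~ J a -> measurable_fun setT (U : cylinderType J -> A) ->
  independent_pair P U (X a).
Proof.
move=> Ja mU C D mC mD.
have mXD := measurable_preimageX a mD.
have : <<s cylinder J >> (U @^-1` C).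
  by have := mU measurableT C mC; rewrite setTI.
apply: (@dynkin_induction _ (cylinderType J) (cylinder J)
  (fun E => P (E `&` X a @^-1` D) = (P E * P (X a @^-1` D))%E)) => //.
- exact: cylinderI.
- by rewrite setTI probability_setT mul1e.
- move=> _ [s [B [us sJ mB ->]]].
  (* The event on [X a] becomes one more coordinate condition, at an index outside [s]. *)
  pose B' b := if b == a then D else B b.
  have as' : a \notin s by apply/negP => /sJ.
  have mB' b : measurable (B' b) by rewrite /B'; case: ifP.
  have := @indepX (a :: s) B'; rewrite /= as' us => /(_ isT mB').
  rewrite big_cons {2}/B' eqxx.
  rewrite (_ : \bigcap_(b in _) _ = \bigcap_(b in [set` s]) X b @^-1` B b `&` X a @^-1` D).
    move=> ->; rewrite muleC (indepX us mB); congr (_ * _)%E.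
    rewrite big_seq [RHS]big_seq; apply: eq_bigr => b bs.
    by rewrite /B'; case: eqP => // ba; move: as'; rewrite -ba bs.
  apply/seteqP; split => w /=.
    move=> h; split.
      move=> b /= bs; have := h b; rewrite /= inE bs orbT => /(_ isT).
      by rewrite /B'; case: eqP => // ba; move: as'; rewrite -ba bs.
    by have := h a; rewrite /= inE eqxx => /(_ isT); rewrite /B' eqxx.
  move=> [h1 h2] b /=; rewrite inE => /orP[/eqP ->|bs].
    by rewrite /B' eqxx.
  rewrite /B'; case: eqP => [->//|_]; exact: h1.
- move=> S mS PS; have mS' : measurable (S : set T) by exact: (@sigma_cylinder_measurable J).
  rewrite setIC -setDE measureD//; last first.
    by rewrite (@le_lt_trans _ _ 1%E)// ?probability_le1// ltry.
  rewrite [_ `&` S]setIC /= PS probability_setC// muleBl ?mul1e ?fin_num_measure ?fin_num_adde_defr//.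
- move=> F mF tF PF.
  have mF' n : measurable (F n : set T).
    exact: (@sigma_cylinder_measurable J _ (mF n)).
  rewrite setI_bigcupl measure_semi_bigcup//; last 3 first.
  + by move=> i; exact: measurableI.
  + apply/trivIsetP => i j _ _ ij; move/trivIsetP : tF => /(_ i j Logic.I Logic.I ij) FF0.
    by rewrite setIACA FF0 set0I.
  + by apply: bigcupT_measurable => i; exact: measurableI.
  rewrite measure_semi_bigcup//; last exact: bigcupT_measurable.
  rewrite /=; under eq_eseriesr do rewrite PF muleC.
  rewrite muleC -(@fineK _ (P (X a @^-1` D))) ?fin_num_measure//.
  by rewrite nneseriesZl.
Qed.

End cylinders.

(** * Converse *)

Lemma measurable_rcons d0 (T0 : measurableType d0) d (A : measurableType d) n
    (f : T0 -> n.-tuple A) (g : T0 -> A) :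
  measurable_fun setT f -> measurable_fun setT g ->
  measurable_fun setT (fun x => [tuple of rcons (f x) (g x)]).
Proof.
move=> mf mg; apply/measurable_fun_tnthP => i.
have [in_|ni] := ltnP i n.
  rewrite (_ : _ \o _ = fun x => tnth (f x) (Ordinal in_)).
    exact: (measurableT_comp (@measurable_tnth _ _ _ (Ordinal in_)) mf).
  apply/funext => x /=.
  by rewrite !(tnth_nth (g x)) /= nth_rcons size_tuple in_.
rewrite (_ : _ \o _ = g)//; apply/funext => x /=.
rewrite (tnth_nth (g x)) /= nth_rcons size_tuple ltnNge ni /=.
by case: eqP.
Qed.

(** * Causality of the transmission *)

Section transmission_theory.
Context (R : realType) (V : finType) (src : V) (G : V -> V -> R) (N0 : R).
Context d (T : measurableType d) (P : probability T R) (ch : channel G N0 P).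
Notation index := ((V * V * nat) + (V * nat))%type.

Definition channel_variable (a : index) : T -> R[i] :=
  match a with
  | inl (i, j, t) => fading ch i j t
  | inr (j, t) => noise ch j t
  end.

Definition variable_time (a : index) : nat :=
  match a with inl (_, _, t) => t | inr (_, t) => t end.

Definition past (t : nat) : set index := [set a | (variable_time a < t)%N].

Lemma measurable_channel_variable a : measurable_fun setT (channel_variable a).
Proof.
by case: a => [[[i j] t]|[j t]]; [exact: fading_measurable|exact: noise_measurable].
Qed.

Lemma channel_variable_independent : mutually_independent P channel_variable.
Proof. exact: fading_noise_independent. Qed.

Definition variablesType (J : set index) := cylinderType channel_variable J.

Lemma variablesType_sub (J K : set index) d' (A : measurableType d') (U : T -> A) :
  J `<=` K -> measurable_fun setT (U : variablesType J -> A) ->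
  measurable_fun setT (U : variablesType K -> A).
Proof.
move=> JK mU _ B mB; have := mU measurableT B mB.
apply: smallest_sub; first exact: sigma_algebra_measurable.
move=> _ [s [C [us sJ mC ->]]]; apply: sub_sigma_algebra.
by exists s, C; split => //; exact: subset_trans JK.
Qed.

Lemma variablesType_measurable (J : set index) d' (A : measurableType d') (U : T -> A) :
  measurable_fun setT (U : variablesType J -> A) -> measurable_fun setT U.
Proof. by apply: cylinderType_measurable => a; exact: measurable_channel_variable. Qed.

Lemma variable_independent (a : index) d' (A : measurableType d') (U : T -> A) :
  measurable_fun setT (U : variablesType [set~ a] -> A) ->
  independent_pair P U (channel_variable a).
Proof.
move=> mU; apply: (cylinder_independent _ channel_variable_independent _ mU).
  exact: measurable_channel_variable.
by move=> /(_ erefl).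
Qed.

Section fixed_code.
Context (n M : nat) (c : Defs.code R V n M) (m : 'I_M).

Definition sent (i : V) (t : nat) (w : T) : R[i] :=
  input src c m i (outputs src ch c m w t i).

(** The noiseless part of the sample received at [j]. The sum may include [j] itself, whose
    coefficient is 0. *)
Definition faded (j : V) (t : nat) (w : T) : R[i] :=
  \sum_(i : V) fading ch i j t w * sent i t w.

Lemma measurable_input i t : measurable_fun setT (@input _ _ src _ _ c m i t).
Proof.
rewrite /input; case: (i == src); last exact: relay_measurable.
exact: measurable_cst.
Qed.

(** Causality: the sample of time [t] is made of fading and noise of time [t], which belong to
    [past t.+1], and of inputs computed from earlier outputs. *)
Lemma measurable_outputs t i :
  measurable_fun setT
    ((fun w => outputs src ch c m w t i) : variablesType (past t) -> t.-tuple R[i]).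
Proof.
elim: t i => [|t IH] i.
  by rewrite (_ : (fun _ => _) = cst [tuple])//; apply/funext.
apply: measurable_rcons.
  by apply: variablesType_sub (IH i) => a; rewrite /past /=; exact: ltnW.
apply: measurable_complexD.
  apply: measurable_complex_sum => l _; apply: measurable_complexM.
    exact: (@measurable_cylinderX _ _ _ _ channel_variable (past t.+1) (inl (l, i, t)) (ltnSn t)).
  apply: measurableT_comp; first exact: measurable_input.
  by apply: variablesType_sub (IH l) => a; rewrite /past /=; exact: ltnW.
exact: (@measurable_cylinderX _ _ _ _ channel_variable (past t.+1) (inr (i, t)) (ltnSn t)).
Qed.

Lemma measurable_sent i t :
  measurable_fun setT (sent i t : variablesType (past t) -> R[i]).
Proof.
rewrite /sent; apply: measurableT_comp; first exact: measurable_input.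
exact: measurable_outputs.
Qed.

Lemma past_sub a t : (t <= variable_time a)%N -> past t `<=` [set~ a].
Proof. by move=> ta b /= bt ba; move: bt; rewrite ba /past /= ltnNge ta. Qed.

(** The signal part at time [t] involves the past and the fading of time [t], but not the noise at
    [j] at that time; hence it is independent of this noise. *)
Lemma measurable_faded j t :
  measurable_fun setT (faded j t : variablesType [set~ inr (j, t)] -> R[i]).
Proof.
apply: measurable_complex_sum => l _; apply: measurable_complexM.
  exact: (@measurable_cylinderX _ _ _ _ channel_variable _ (inl (l, j, t))).
apply: (@variablesType_sub (past t)); last exact: measurable_sent.
exact: past_sub.
Qed.

(** What [j] would record if nobody transmitted: the reference law of the converse. *)
Fixpoint noises (j : V) (t : nat) (w : T) : t.-tuple R[i] :=
  match t with
  | 0%N => [tuple]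
  | u.+1 => [tuple of rcons (noises j u w) (noise ch j u w)]
  end.

Lemma measurable_noises j t :
  measurable_fun setT (noises j t : variablesType (past t) -> t.-tuple R[i]).
Proof.
elim: t => [|t IH].
  by rewrite (_ : noises j 0 = cst [tuple])//; apply/funext.
apply: measurable_rcons.
  by apply: variablesType_sub IH => a; rewrite /past /=; exact: ltnW.
exact: (@measurable_cylinderX _ _ _ _ channel_variable (past t.+1) (inr (j, t)) (ltnSn t)).
Qed.

End fixed_code.
End transmission_theory.

Arguments measurable_noises {R V G N0 d T P} ch j t.
Arguments measurable_outputs {R V} src {G N0 d T P} ch {n M} c m t i.
Arguments measurable_faded {R V} src {G N0 d T P} ch {n M} c m j t.
Arguments measurable_sent {R V} src {G N0 d T P} ch {n M} c m i t.
Arguments variablesType_sub {R V G N0 d T P ch J K d' A U}.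
Arguments variablesType_measurable {R V G N0 d T P ch J d' A U}.
Arguments variable_independent {R V G N0 d T P ch} a {d' A U}.
Arguments past_sub {V} a {t}.

(** * Gibbs inequality along a whole transmission *)

Section gibbs_induction.
Context (R : realType) (V : finType) (src : V) (G : V -> V -> R) (N0 : R).
Context d (T : measurableType d) (P : probability T R) (ch : channel G N0 P).
Hypothesis N0_gt0 : 0 < N0.

Let mnoise j t : measurable_fun setT (noise ch j t) := noise_measurable ch j t.

Section node.
Context (n M : nat) (c : Defs.code R V n M) (m : 'I_M) (j : V).

Definition received_energy (t : nat) : \bar R :=
  (\int[P]_w (csqnorm (faded src ch c m j t w))%:E)%E.

(** The last noise sample is independent of the earlier ones, so it can be averaged out
    separately. *)
Lemma noises_average t (f : t.+1.-tuple R[i] -> R) (C : R) :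
  measurable_fun setT f -> (forall y, 0 <= f y <= C) ->
  \int[P]_w \int[P]_v f [tuple of rcons (noises ch j t w) (noise ch j t v)]
  = \int[P]_w f (noises ch j t.+1 w).
Proof.
move=> mf f0C.
have f0 y : 0 <= f y by case/andP: (f0C y).
pose h (p : t.-tuple R[i] * R[i]) := (f [tuple of rcons p.1 p.2])%:E.
have mh : measurable_fun setT h.
  apply/measurable_EFinP; apply: (measurableT_comp mf).
  by apply: measurable_rcons.
have h0 p : (0 <= h p)%E by rewrite lee_fin.
have mN : measurable_fun setT (noises ch j t).
  exact: variablesType_measurable (measurable_noises ch j t).
have ind : independent_pair P (noises ch j t) (noise ch j t).
  exact: (variable_independent (inr (j, t))
    (variablesType_sub (past_sub (inr (j, t)) (leqnn t)) (measurable_noises ch j t))).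
have := independent_pair_integral mN (mnoise j t) ind mh h0.
rewrite /h /= => E; rewrite /Rintegral [in RHS]E; congr fine.
apply: eq_integral => w _; rewrite fineK//.
have mc : measurable_fun setT
    (fun v => f [tuple of rcons (noises ch j t w) (noise ch j t v)]).
  by apply: (measurableT_comp mf); apply: measurable_rcons.
have := @probability_bounded_integrable _ _ _ P _ 0 C mc (fun v => f0C _).
by move=> /(integrable_fin_num measurableT).
Qed.

(** Induction on time: [complex_gibbs] pays for replacing the last sample by pure noise, and the
    averaged function of the earlier samples goes to the induction hypothesis. *)
Lemma outputs_gibbs t (f : t.-tuple R[i] -> R) (C : R) :
  measurable_fun setT f -> (forall y, 1 <= f y <= C) ->
  (\int[P]_w (ln (f (outputs src ch c m w t j)))%:E
   <= (ln (\int[P]_w f (noises ch j t w)))%:E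
      + N0^-1%:E * \sum_(u < t) received_energy u)%E.
Proof.
elim: t f => [|t IH] f mf f1C.
  rewrite big_ord0 mule0 adde0 /=.
  by rewrite Rintegral_cst// integral_cst//= probability_setT mule1 mulr1.
have f_gt0 y : 0 < f y by case/andP: (f1C y) => /(lt_le_trans ltr01).
have f0C y : 0 <= f y <= C by case/andP: (f1C y) => _ ->; rewrite ltW.
have mNt := variablesType_measurable (measurable_noises ch j t).
have mYt := variablesType_measurable (measurable_outputs src ch c m t j).
have mSt := variablesType_measurable (measurable_faded src ch c m j t).
pose k (p : t.-tuple R[i] * T) := f [tuple of rcons p.1 (noise ch j t p.2)].
have mk : measurable_fun setT k.
  apply: (measurableT_comp mf); apply: measurable_rcons => //.
  by apply: measurableT_comp.
(* Averaging over a last sample of pure noise keeps the bounds 1 and [C], and by [noises_average]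
   the mean of [f'] under the earlier noises is that of [f]. *)
pose f' y := \int[P]_v k (y, v).
have mf' : measurable_fun setT f'.
  by apply: measurable_Rintegral_param => // p; exact/ltW/f_gt0.
have f'1C y : 1 <= f' y <= C.
  apply: probability_Rintegral_bound => [|v]; last exact: f1C.
  exact: (measurableT_comp mk (pair1_measurable y)).
have f'_gt0 y : 0 < f' y by case/andP: (f'1C y) => /(lt_le_trans ltr01).
have := IH f' mf' f'1C.
rewrite {2}/f' /k /= (noises_average mf f0C) => IHf.
rewrite big_ord_recr /= ge0_muleDr; last 2 first.
- by apply: sume_ge0 => u _; apply: integral_ge0 => w _; rewrite lee_fin csqnorm_ge0.
- by apply: integral_ge0 => w _; rewrite lee_fin csqnorm_ge0.
rewrite addeA; apply: le_trans (leeD2r _ IHf).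
(* Past outputs and signal part may depend on each other, but jointly they are independent of the
   noise at time [t]. *)
pose U w := (outputs src ch c m w t j, faded src ch c m j t w).
have mUa : measurable_fun setT
    (U : variablesType ch [set~ inr (j, t)] -> t.-tuple R[i] * R[i]).
  apply: measurable_fun_pair; last exact: measurable_faded.
  exact: (variablesType_sub (past_sub (inr (j, t)) (leqnn t)) (measurable_outputs src ch c m t j)).
have mU := variablesType_measurable mUa.
have ind := variable_independent (inr (j, t)) mUa.
pose h (p : (t.-tuple R[i] * R[i]) * R[i]) :=
  (ln (f [tuple of rcons p.1.1 (p.1.2 + p.2)]))%:E.
have mh : measurable_fun setT h.
  apply/measurable_EFinP; apply: measurableT_comp => //.
  apply: (measurableT_comp mf); apply: measurable_rcons.
    by apply: measurableT_comp.
  by apply: measurable_complexD => //; apply: measurableT_comp.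
have h0 p : (0 <= h p)%E by rewrite lee_fin ln_ge0//; case/andP: (f1C [tuple of rcons p.1.1 (p.1.2 + p.2)]).
have /= -> := independent_pair_integral mU (mnoise j t) ind mh h0.
rewrite -ge0_integralZl//; last 3 first.
- by apply/measurable_EFinP; exact: measurable_csqnorm.
- by move=> w _; rewrite lee_fin csqnorm_ge0.
- by rewrite lee_fin invr_ge0 ltW.
have mlf' : measurable_fun setT (fun w => ln (f' (outputs src ch c m w t j))).
  by apply: measurableT_comp => //; apply: (measurableT_comp mf').
have mS2 : measurable_fun setT (fun w => (N0^-1)%:E * (csqnorm (faded src ch c m j t w))%:E)%E.
  by apply: measurable_funeM; apply/measurable_EFinP; exact: measurable_csqnorm.
rewrite -ge0_integralD//; last 3 first.
- by move=> w _; rewrite lee_fin ln_ge0//; case/andP: (f'1C (outputs src ch c m w t j)).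
- exact/measurable_EFinP.
- by move=> w _; rewrite mule_ge0// lee_fin ?csqnorm_ge0// invr_ge0 ltW.
pose hT (q : (t.-tuple R[i] * R[i]) * T) := h (q.1, noise ch j t q.2).
have mhT : measurable_fun setT hT.
  apply: (measurableT_comp mh); apply: measurable_fun_pair => //.
  exact: measurableT_comp.
have mF := measurable_fun_fubini_tonelli_F (m2 := P) hT mhT (fun q => h0 _).
apply: ge0_le_integral => //.
- by move=> w _; apply: integral_ge0.
- exact: (measurableT_comp mF mU).
- by apply: emeasurable_funD => //; exact/measurable_EFinP.
move=> w _; rewrite /h /=.
set y := outputs _ _ _ _ _ _ _; set s := faded _ _ _ _ _ _ _.
have mfz : measurable_fun setT (fun z => f [tuple of rcons y z]).
  apply: (measurableT_comp mf); apply: measurable_rcons.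
    exact: measurable_cst.
  exact: measurable_id.
(* With the past [y] and the signal [s] frozen, the integrands compare by the one-sample
   inequality. *)
have := complex_gibbs (C := C) s N0_gt0 (mnoise j t) (noise_normal ch j t) mfz
  (fun z => f1C _).
rewrite -lee_fin EFinD; congr (_ <= _)%E; last by rewrite EFinM muleC.
rewrite -(@probability_EFin_Rintegral _ _ _ P _ 0 (ln C))//.
  apply: measurableT_comp => //; apply: (measurableT_comp mfz).
  by apply: measurable_complexD.
move=> v; have /andP[h1 h2] := f1C [tuple of rcons y (s + noise ch j t v)].
by rewrite ln_ge0// ler_ln// posrE ?f_gt0// (lt_le_trans (f_gt0 _) h2).
Qed.
End node.
End gibbs_induction.

(** * Sent and received energy of a code *)

Section decoding.
Context (R : realType) (V : finType) (src : V) (G : V -> V -> R) (N0 : R).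
Context d (T : measurableType d) (P : probability T R) (ch : channel G N0 P).
Context (n M : nat) (c : Defs.code R V n M).

Definition sent_energy_at (m : 'I_M) (i : V) (t : nat) : \bar R :=
  (\int[P]_w (csqnorm (sent src ch c m i t w))%:E)%E.

Lemma sent_energy_at_ge0 m i t : (0 <= sent_energy_at m i t)%E.
Proof. by apply: integral_ge0 => w _; rewrite lee_fin csqnorm_ge0. Qed.

Lemma expected_energyE : (expected_energy src ch c =
  (M%:R^-1)%:E * \sum_(m < M) \sum_(i : V) \sum_(t < n) sent_energy_at m i t)%E.
Proof.
rewrite /expected_energy; congr (_ * _)%E; apply: eq_bigr => m _.
rewrite unlock /= /sent_energy.
under eq_integral => w _.
  rewrite -sumEFin; under eq_bigr do rewrite -sumEFin.
  over.
rewrite ge0_integral_sum//; last 2 first.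
- move=> i; apply: emeasurable_sum => t; apply/measurable_EFinP.
  apply: measurable_csqnorm.
  exact: (variablesType_measurable (measurable_sent src ch c m i t)).
- by move=> i w _; apply: sume_ge0 => t _; rewrite lee_fin csqnorm_ge0.
apply: eq_bigr => i _; rewrite ge0_integral_sum//.
- move=> t; apply/measurable_EFinP; apply: measurable_csqnorm.
  exact: (variablesType_measurable (measurable_sent src ch c m i t)).
- by move=> t w _; rewrite lee_fin csqnorm_ge0.
Qed.

(* E |h x + r|^2 = E |h|^2 E |x|^2 + E |r|^2, because h and - h have the same
   law and are independent of (x, r). *)
Lemma circular_energyD (i j : V) (t : nat) (x r : T -> R[i]) : i != j ->
  measurable_fun setT (x : variablesType ch [set~ inl (i, j, t)] -> R[i]) ->
  measurable_fun setT (r : variablesType ch [set~ inl (i, j, t)] -> R[i]) ->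
  (\int[P]_w (csqnorm (fading ch i j t w * x w + r w))%:E
   = (G i j)%:E * \int[P]_w (csqnorm (x w))%:E + \int[P]_w (csqnorm (r w))%:E)%E.
Proof.
move=> ij mx mr; set h := fading ch i j t.
have mh : measurable_fun setT h by exact: fading_measurable.
have mU := measurable_fun_pair mx mr.
have ind := variable_independent (inl (i, j, t)) mU.
have mx' := variablesType_measurable mx.
have mr' := variablesType_measurable mr.
have mU' := variablesType_measurable mU.
pose f (p : (R[i] * R[i]) * R[i]) := (csqnorm (p.2 * p.1.1 + p.1.2))%:E.
have mf : measurable_fun setT f.
  apply/measurable_EFinP; apply: measurable_csqnorm.
  apply: measurable_complexD; last exact: measurableT_comp.
  by apply: measurable_complexM => //; exact: measurableT_comp.
have f0 p : (0 <= f p)%E by rewrite lee_fin csqnorm_ge0.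
have /= -> := independent_pair_integral mU' mh ind mf f0.
have hE : (\int[P]_v (csqnorm (h v))%:E = (G i j)%:E)%E.
  by rewrite -(fading_moment ch t ij) unlock.
have Gij0 : 0 <= G i j.
  by rewrite -lee_fin -hE; apply: integral_ge0 => w _; rewrite lee_fin csqnorm_ge0.
have inner y z : (\int[P]_v f ((y, z), h v) = (G i j)%:E * (csqnorm y)%:E + (csqnorm z)%:E)%E.
  pose g u := f ((y, z), u).
  have mg : measurable_fun setT g by exact: (measurableT_comp mf (pair1_measurable _)).
  have g0 u : (0 <= g u)%E by exact: f0.
  have mgh : measurable_fun setT (fun v => g (h v)) by exact: measurableT_comp mg mh.
  have mgNh : measurable_fun setT (fun v => g (- h v)).
    apply/measurable_EFinP; apply: measurable_csqnorm.
    apply: measurable_complexD => //; apply: measurable_complexM => //.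
    rewrite (_ : (fun v => _) = (fun v => cis pi * h v)).
      exact: measurable_complexM.
    by apply/funext => v; rewrite cis_pi mulN1r.
  have E1 := circular_integralN mh (fading_circular ch t ij) mg g0.
  have mhE : measurable_fun setT (fun v => (csqnorm (h v))%:E).
    by apply/measurable_EFinP; exact: measurable_csqnorm.
  have : (\int[P]_v (g (h v) + g (- h v)%R) =
          (2 * (G i j * csqnorm y + csqnorm z))%:E)%E.
    transitivity (\int[P]_v ((2 * csqnorm y)%:E * (csqnorm (h v))%:E + (2 * csqnorm z)%:E))%E.
      apply: eq_integral => v _; rewrite /g /f /= -EFinD mulNr csqnorm_parallelogram.
      by rewrite csqnormM -EFinM -EFinD; congr EFin; ring.
    rewrite ge0_integralD//; last 3 first.
    - by move=> v _; rewrite -EFinM lee_fin ?mulr_ge0 ?csqnorm_ge0.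
    - exact: measurable_funeM.
    - by move=> v _; rewrite lee_fin mulr_ge0 ?csqnorm_ge0.
    rewrite ge0_integralZl//; last 2 first.
    - by move=> v _; rewrite lee_fin csqnorm_ge0.
    - by rewrite lee_fin mulr_ge0 ?csqnorm_ge0.
    rewrite hE integral_cst//= probability_setT mule1.
    by rewrite -EFinM -EFinD; congr EFin; ring.
  rewrite ge0_integralD// E1 -EFinM -EFinD -/(g _).
  (* Twice this integral is finite, which rules out the infinite values. *)
  case: (\int[P]_v g (h v))%E => [u [E2]|//|//]; congr EFin; lra.
under eq_integral do rewrite inner.
rewrite ge0_integralD//; last 4 first.
- by move=> w _; rewrite mule_ge0 ?lee_fin ?csqnorm_ge0.
- by apply: measurable_funeM; apply/measurable_EFinP; exact: measurable_csqnorm.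
- by move=> w _; rewrite lee_fin csqnorm_ge0.
- by apply/measurable_EFinP; exact: measurable_csqnorm.
rewrite ge0_integralZl//.
- by apply/measurable_EFinP; exact: measurable_csqnorm.
- by move=> w _; rewrite lee_fin csqnorm_ge0.
Qed.

(** Transmitters are peeled off one at a time. The enumeration has no repetition, so the coefficient
    of the peeled one does not occur in the remaining sum, as [circular_energyD] requires; the term
    of [j] vanishes with its coefficient. *)
Lemma received_energyE (m : 'I_M) (j : V) (t : nat) :
  (received_energy src ch c m j t =
   \sum_(i | i != j) (G i j)%:E * sent_energy_at m i t)%E.
Proof.
rewrite /received_energy.
under eq_integral do rewrite /faded.
rewrite big_mkcond /=.
have : uniq (index_enum V) by exact: index_enum_uniq.
elim: (index_enum V) => [_|i s IH /= /andP[ins us]].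
  under eq_integral do rewrite big_nil csqnorm0.
  by rewrite big_nil integral0.
under eq_integral do rewrite big_cons.
rewrite big_cons -(IH us); case: eqVneq => [->|ij] /=.
  by under eq_integral do rewrite fading_self mul0r add0r; rewrite add0e.
have msent l := variablesType_sub (past_sub (inl (i, j, t)) (leqnn t))
  (measurable_sent src ch c m l t).
rewrite circular_energyD//.
apply: measurable_complex_sum => l ls; apply: measurable_complexM; last exact: msent.
apply: (@measurable_cylinderX _ _ _ _ (channel_variable ch) _ (inl (l, j, t))).
by move=> [li]; move: ins; rewrite -li ls.
Qed.

End decoding.

(** * Converse for a code and for [Eb_min] *)

Section converse.
Context (R : realType) (V : finType) (src : V) (G : V -> V -> R) (N0 : R).
Context d (T : measurableType d) (P : probability T R) (ch : channel G N0 P).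
Hypothesis N0_gt0 : 0 < N0.
Context (n M : nat) (c : Defs.code R V n M).
Hypothesis M_gt0 : (0 < M)%N.

Let M1 : 1 <= M%:R :> R. Proof. by rewrite ler1n. Qed.

Definition correct (m : 'I_M) (j : V) : set T :=
  [set w | decoder c j (outputs src ch c m w n j) = m].

(** Decoding [m] from pure noise. As [m] varies, these events partition the space. *)
Definition guess (m : 'I_M) (j : V) : set T :=
  [set w | decoder c j (noises ch j n w) = m].

Lemma measurable_correct m j : measurable (correct m j).
Proof.
have := variablesType_measurable (measurable_outputs src ch c m n j).
by move=> /(_ measurableT _ (decoder_measurable c j m)); rewrite setTI.
Qed.

Lemma measurable_guess m j : measurable (guess m j).
Proof.
have := variablesType_measurable (measurable_noises ch j n).
by move=> /(_ measurableT _ (decoder_measurable c j m)); rewrite setTI.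
Qed.

Lemma sum_guess j : (\sum_(m < M) P (guess m j) = 1)%E.
Proof.
transitivity (\sum_(m < M) \int[P]_w (\1_(guess m j) w)%:E)%E.
  by apply: eq_bigr => m _; rewrite integral_indic ?setIT//; exact: measurable_guess.
rewrite -ge0_integral_sum//; last first.
  by move=> m; apply/measurable_EFinP/measurable_indic; exact: measurable_guess.
rewrite -[RHS](probability_setT P) -[in RHS](setIT setT) -integral_indic//.
apply: eq_integral => w _; rewrite sumEFin indicT; congr EFin.
rewrite (bigD1 (decoder c j (noises ch j n w)))//= indicE mem_set//.
rewrite big1 ?addr0// => m mw; rewrite indicE memNset// => /esym mE.
by move: mw; rewrite mE eqxx.
Qed.

(** [outputs_gibbs] is applied to [f] equal to [M] on the decoding region of [m] and to 1 elsewhere.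
    The mean of [ln f] is [ln M] times the probability of success, and [ln (1 + (M - 1) q) <= M q]
    for [q] the probability of guessing [m]. *)
Lemma decoding_bound m j :
  ((ln M%:R)%:E * P (correct m j) <= (M%:R)%:E * P (guess m j)
    + N0^-1%:E * \sum_(t < n) received_energy src ch c m j t)%E.
Proof.
pose B := [set y | decoder c j y = m].
have mB : measurable B by exact: decoder_measurable.
pose f (y : n.-tuple R[i]) : R := 1 + (M%:R - 1) * \1_B y.
have M10 : 0 <= M%:R - 1 :> R by rewrite subr_ge0.
have mf : measurable_fun setT f.
  by apply: measurable_funD => //; apply: measurable_funM => //; exact: measurable_indic.
have f1M y : 1 <= f y <= M%:R.
  rewrite /f indicE; case: (y \in B); rewrite ?mulr1 ?mulr0 ?addr0 ?lexx//.
  by rewrite addrC subrK lexx M1.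
have := outputs_gibbs src ch N0_gt0 c m j mf f1M.
have lnf y : ln (f y) = ln M%:R * \1_B y.
  rewrite /f indicE; case: (y \in B); last by rewrite !mulr0 addr0 ln1.
  by rewrite !mulr1 addrC subrK.
under eq_integral do rewrite lnf EFinM.
have miY : measurable_fun setT (fun w => (\1_B (outputs src ch c m w n j))%:E : \bar R).
  apply/measurable_EFinP; apply: measurableT_comp; first exact: measurable_indic.
  exact: variablesType_measurable (measurable_outputs src ch c m n j).
have i0 w : (0 <= (\1_B (outputs src ch c m w n j))%:E :> \bar R)%E by rewrite lee_fin.
have lnM0 : (0 <= (ln M%:R : R)%:E)%E by rewrite lee_fin ln_ge0.
rewrite (ge0_integralZl P measurableT miY (fun w _ => i0 w) lnM0).
have indE (U : T -> n.-tuple R[i]) : (fun w => (\1_B (U w))%:E : \bar R)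
    = (fun w => (\1_(U @^-1` B) w)%:E).
  by apply/funext => w; rewrite !indicE.
rewrite (indE (fun w => outputs src ch c m w n j)).
rewrite integral_indic//; last exact: measurable_correct.
rewrite setIT => /le_trans; apply.
rewrite leeD2r//.
have -> : \int[P]_w f (noises ch j n w) = 1 + (M%:R - 1) * fine (P (guess m j)).
  rewrite /Rintegral /f.
  under eq_integral do rewrite EFinD EFinM.
  have mi : measurable_fun setT (fun w => (\1_B (noises ch j n w))%:E : \bar R).
    apply/measurable_EFinP; apply: measurableT_comp; first exact: measurable_indic.
    exact: variablesType_measurable (measurable_noises ch j n).
  rewrite ge0_integralD//; last 2 first.
  - by move=> w _; rewrite mule_ge0// lee_fin.
  - exact: measurable_funeM.
  rewrite ge0_integralZl// (indE (fun w => noises ch j n w)).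
  rewrite integral_indic//; last exact: measurable_guess.
  rewrite setIT integral_cst//= probability_setT mule1.
  have gf : P (guess m j) \is a fin_num by apply: fin_num_measure; exact: measurable_guess.
  by rewrite -(fineK gf) -EFinM -EFinD.
have gf : P (guess m j) \is a fin_num by apply: fin_num_measure; exact: measurable_guess.
have g0 : 0 <= fine (P (guess m j)) by rewrite fine_ge0.
rewrite -[in leRHS](fineK gf) -EFinM lee_fin.
set q := fine _.
have : 0 <= (M%:R - 1) * q by rewrite mulr_ge0.
move=> h; apply: (@le_trans _ _ ((M%:R - 1) * q)).
  by apply: le_ln1Dx; rewrite (lt_le_trans _ h)// oppr_lt0.
by rewrite ler_wpM2r// gerBl.
Qed.

Lemma correct_ge eps j : j != src -> (error_probability src ch c <= eps%:E)%E ->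
  ((M%:R * (1 - eps))%:E <= \sum_(m < M) P (correct m j))%E.
Proof.
move=> jsrc; rewrite /error_probability => err.
have M0 : 0 < M%:R :> R by rewrite ltr0n.
set Err := fun m : 'I_M => [set w | exists2 i, i != src & decoder c i (outputs src ch c m w n i) <> m] in err.
have mErr m : measurable (Err m).
  rewrite (_ : Err m = \bigcup_(i in [set` [set i | i != src]%SET]) ~` correct m i).
    by apply: fin_bigcup_measurable => // i _; exact/measurableC/measurable_correct.
  apply/seteqP; split => w /=.
    by move=> [i isrc e]; exists i => //; rewrite /= inE.
  by move=> [i /=]; rewrite inE => isrc e; exists i.
have Pc m : P (correct m j) = (1 - fine (P (~` correct m j)))%:E.
  have mC := measurable_correct m j.
  rewrite EFinB fineK; last by apply: fin_num_measure; exact: measurableC.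
  by rewrite -probability_setC ?setCK//; exact: measurableC.
have le m : (fine (P (~` correct m j)) <= fine (P (Err m))).
  apply: fine_le.
  - by apply: fin_num_measure; apply: measurableC; exact: measurable_correct.
  - by apply: fin_num_measure.
  apply: le_measure; rewrite ?inE//.
    by apply: measurableC; exact: measurable_correct.
  by move=> w h; exists j.
under eq_bigr do rewrite Pc.
rewrite sumEFin lee_fin sumrB sumr_const card_ord -[X in _ <= X - _]/(M%:R).
have : \sum_(m < M) fine (P (Err m)) <= M%:R * eps.
  rewrite -ler_pdivrMl// -lee_fin EFinM -sumEFin; apply: le_trans err.
  by under eq_bigr do rewrite fineK ?fin_num_measure//.
have := @ler_sum R 'I_M (index_enum _) predT _ _ (fun m _ => le m).
lra.
Qed.

(** A Fano-type inequality. [decoding_bound] is summed over the messages, where the guessing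
    probabilities add up to 1, and over [D], where each transmitter's energy gets weighted by its
    total gain to [D]. *)
Theorem code_converse (D : {set V}) (Gmax E eps : R) : src \notin D -> 0 <= Gmax ->
  (forall i, \sum_(j in D | i != j) G i j <= Gmax) ->
  (forall i j, 0 <= G i j) ->
  is_code src ch E eps c ->
  #|D|%:R * (1 - eps) * ln M%:R <= #|D|%:R + Gmax * E / N0.
Proof.
move=> srcD Gmax0 GD G0 [enE errE].
have M0 : 0 < M%:R :> R by rewrite ltr0n.
pose e m i := (\sum_(t < n) sent_energy_at src ch c m i t)%E.
have e0 m i : (0 <= e m i)%E by apply: sume_ge0 => t _; exact: sent_energy_at_ge0.
have N0i : 0 <= N0^-1 by rewrite invr_ge0 ltW.
pose S := (\sum_(m < M) \sum_(i : V) e m i)%E.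
have S0 : (0 <= S)%E by apply: sume_ge0 => m _; exact: sume_ge0.
have SE : (S <= (M%:R * E)%:E)%E.
  move: enE; rewrite expected_energyE -/S => h.
  have : ((M%:R)%:E * ((M%:R^-1)%:E * S) <= (M%:R)%:E * E%:E)%E.
    by rewrite lee_pmul2l// lte_fin.
  by rewrite muleA -EFinM divff ?gt_eqF// mul1e.
(* Messages are summed instead of averaged; the resulting factor [M] is cancelled at the end. *)
have node j : j \in D -> ((ln M%:R * (M%:R * (1 - eps)))%:E <= (M%:R)%:E
    + N0^-1%:E * \sum_(m < M) \sum_(i | i != j) (G i j)%:E * e m i)%E.
  move=> jD; have jsrc : j != src by apply: contraNneq srcD => <-.
  rewrite EFinM.
  apply: (@le_trans _ _ ((ln M%:R)%:E * \sum_(m < M) P (correct m j)))%E.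
    by rewrite lee_wpmul2l ?lee_fin ?ln_ge0//; exact: correct_ge.
  rewrite ge0_sume_distrr//.
  apply: (@le_trans _ _ (\sum_(m < M) ((M%:R)%:E * P (guess m j)
    + N0^-1%:E * \sum_(t < n) received_energy src ch c m j t))%E).
    by apply: lee_sum => m _; exact: decoding_bound.
  rewrite big_split /= -ge0_sume_distrr// sum_guess mule1 leeD2l//.
  rewrite -ge0_sume_distrr; last first.
    by move=> m _; apply: sume_ge0 => t _; apply: integral_ge0 => w _; rewrite lee_fin csqnorm_ge0.
  rewrite lee_wpmul2l ?lee_fin//; apply: lee_sum => m _.
  under eq_bigr do rewrite received_energyE.
  rewrite exchange_big /=; apply: lee_sum => i ij.
  by rewrite -ge0_sume_distrr// => t _; exact: sent_energy_at_ge0.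
have total : (\sum_(j in D) (ln M%:R * (M%:R * (1 - eps)))%:E <=
    \sum_(j in D) ((M%:R)%:E
    + N0^-1%:E * \sum_(m < M) \sum_(i | i != j) (G i j)%:E * e m i))%E.
  exact: lee_sum.
have Ge0 j m i : (0 <= (G i j)%:E * e m i)%E by rewrite mule_ge0 ?lee_fin.
have swap : (\sum_(j in D) \sum_(m < M) \sum_(i | i != j) (G i j)%:E * e m i
    <= Gmax%:E * S)%E.
  rewrite exchange_big /= /S ge0_sume_distrr; last by move=> m _; exact: sume_ge0.
  apply: lee_sum => m _; rewrite ge0_sume_distrr//.
  rewrite (exchange_big_dep predT)//=; apply: lee_sum => i _.
  rewrite -ge0_sume_distrl; last by move=> j _; rewrite lee_fin.
  by rewrite sumEFin lee_wpmul2r ?lee_fin.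
have : (\sum_(j in D) (ln M%:R * (M%:R * (1 - eps)))%:E <=
    (#|D|%:R * M%:R)%:E + N0^-1%:E * (Gmax%:E * (M%:R * E)%:E))%E.
  apply: le_trans total _; rewrite big_split /=; apply: leeD.
    by rewrite sumEFin sumr_const -[_ *+ #|D|]mulr_natl.
  rewrite -ge0_sume_distrr; last by move=> j _; apply: sume_ge0 => m _; exact: sume_ge0.
  rewrite lee_wpmul2l ?lee_fin//; apply: le_trans swap _.
  by rewrite lee_wpmul2l ?lee_fin.
rewrite sumEFin sumr_const -[_ *+ #|D|]mulr_natl -!EFinM -EFinD lee_fin => h.
rewrite -(ler_pM2l M0).
have -> : M%:R * (#|D|%:R * (1 - eps) * ln M%:R)
  = #|D|%:R * (ln M%:R * (M%:R * (1 - eps))) by ring.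
apply: le_trans h _.
by rewrite le_eqVlt; apply/orP; left; apply/eqP; ring.
Qed.

End converse.

(** [code_converse] is divided by [log2 M]. At large energy the rate condition forces [M] to be
    large, so the constant term is negligible; then [delta], used both as error probability and as
    slack, tends to 0. *)
Lemma Eb_min_ge (R : realType) (V : finType) (src : V) (G : V -> V -> R) (N0 : R)
    d (T : measurableType d) (P : probability T R) (ch : channel G N0 P)
    (D : {set V}) (Gmax : R) : 0 < N0 -> src \notin D -> 0 < Gmax ->
  (forall i j, 0 <= G i j) ->
  (forall i, \sum_(j in D | i != j) G i j <= Gmax) ->
  ((#|D|%:R * (N0 * ln 2) / Gmax)%:E <= Eb_min src ch)%E.
Proof.
move=> N00 srcD Gmax0 G0 GD; apply: le_ereal_inf_tmp => _ [Eb [Eb0 ach] <-].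
rewrite lee_fin.
set D' : R := #|D|%:R; pose a := D' * ln 2; pose b := Gmax / N0.
have D'0 : 0 <= D' by [].
have ln20 : 0 < ln 2 :> R by rewrite ln_gt0// ltr1n.
have a0 : 0 <= a by rewrite mulr_ge0// ltW.
have b0 : 0 < b by rewrite divr_gt0.
suff : a <= b * Eb.
  rewrite /a /b ler_pdivrMr// => h.
  have : N0 * (D' * ln 2) <= N0 * (Gmax / N0 * Eb) by rewrite ler_pM2l.
  rewrite (_ : N0 * (Gmax / N0 * Eb) = Eb * Gmax); last by field; rewrite gt_eqF.
  by rewrite mulrCA.
have key delta : 0 < delta < 1 -> a * (1 - delta) <= delta + b * (Eb + delta).
  move=> /andP[d0 d1]; have Ebd : 0 < Eb + delta by rewrite ltr_wpDl.
  have [E0 hE0] := ach delta (introT andP (conj d0 d1)) delta d0.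
  (* Together with [E < (Eb + delta) * L], the second bound gives [D' <= delta * L]. *)
  pose E := Num.max E0 (D' * (Eb + delta) / delta).
  have [|n [M [M1 [c codec] rate]]] := hE0 E; first by rewrite le_max lexx.
  have M0 : (0 < M)%N by exact: ltnW.
  pose L : R := log2 M%:R.
  have lnM : ln M%:R = L * ln 2 by rewrite /L /log2 divfK// gt_eqF.
  have L0 : 0 < L by rewrite divr_gt0// ln_gt0// ltr1n.
  have EL : E < (Eb + delta) * L by rewrite -ltr_pdivrMr.
  have DE : D' * (Eb + delta) / delta <= E by rewrite le_max lexx orbT.
  have DL : D' <= delta * L.
    have h := ltW (le_lt_trans DE EL).
    rewrite ler_pdivrMr// -mulrA [D' * _]mulrC ler_pM2l// in h.
    by rewrite mulrC.
  have := code_converse N00 M0 srcD (ltW Gmax0) GD G0 codec.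
  rewrite lnM -/D' => conv.
  have h2 : Gmax * E / N0 <= b * (Eb + delta) * L.
    rewrite /b mulrAC -/b -mulrA ler_pM2l//; exact: ltW.
  rewrite -(ler_pM2r L0) mulrDl.
  have -> : a * (1 - delta) * L = D' * (1 - delta) * (L * ln 2) by rewrite /a; ring.
  by apply: le_trans conv _; apply: lerD.
apply/ler_addgt0Pr => e e0.
(* [key] rearranges to [a <= b * Eb + delta * (1 + a + b)], so [delta * k <= e] suffices. *)
pose k := 1 + a + b.
have k0 : 0 < k by rewrite /k; lra.
pose delta := Num.min (1 / 2) (e / k).
have d0 : 0 < delta by rewrite lt_min !divr_gt0.
have d1 : delta < 1 by rewrite gt_min; apply/orP; left; lra.
have dk : delta * k <= e by rewrite -ler_pdivlMr// ge_min lexx orbT.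
have := key delta; rewrite d0 d1 => /(_ isT) h.
move: h dk; rewrite /k; clear; move: delta => delta; nra.
Qed.

(** * Gains on the grid *)

Section series_bounds.
Context {R : realType}.
Implicit Types (a c u : R).

(** The right side is the integral of x^-(1+c) from [m] to [m.+1]. With t = m / (m + 1), the bound
    follows from t^-c >= 1 - c ln t >= 1 + c (1 - t). *)
Lemma powRN_telescope c (m : nat) : 0 < c -> (0 < m)%N ->
  (m.+1%:R `^ (1 + c))^-1 <= (m%:R `^ (- c) - m.+1%:R `^ (- c)) / c :> R.
Proof.
move=> c0 m0; have mR : 0 < m%:R :> R by rewrite ltr0n.
have m1R : 0 < m.+1%:R :> R by rewrite ltr0n.
pose t : R := m%:R / m.+1%:R.
have t0 : 0 < t by rewrite divr_gt0.
have mE : m%:R = t * m.+1%:R :> R by rewrite divfK// gt_eqF.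
have t1 : 1 - t = m.+1%:R^-1 by rewrite /t -natr1; field; rewrite natr1 gt_eqF.
have key : 1 + c / m.+1%:R <= t `^ (- c).
  rewrite /powR gt_eqF//; apply: le_trans (expR_ge1Dx _); rewrite lerD2l.
  rewrite -t1 mulNr -mulrN ler_pM2l// -lerN2 opprK opprB.
  have := @le_ln1Dx R (t - 1); rewrite addrCA subrr addr0; apply.
  by rewrite ltrBrDl subrr.
rewrite ler_pdivlMr// mE powRM ?(ltW t0) ?(ltW m1R)//; set A := m.+1%:R `^ (- c).
have -> : t `^ (- c) * A - A = (t `^ (- c) - 1) * A by ring.
have -> : (m.+1%:R `^ (1 + c))^-1 * c = (c / m.+1%:R) * A.
  rewrite powRD; last by rewrite (gt_eqF m1R) implybT.
  by rewrite powRr1 ?ltW// invfM /A powRN mulrC mulrA.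
by apply: ler_wpM2r; rewrite ?powR_ge0// lerBrDl.
Qed.

Lemma powRN_tail c (m n : nat) : 0 < c -> (0 < m)%N ->
  \sum_(m.+1 <= l < n) (l%:R `^ (1 + c))^-1 <= m%:R `^ (- c) / c :> R.
Proof.
move=> c0 m0.
(* The subtracted last term makes the bound telescope by induction on [n]. *)
suff H : (m <= n)%N -> \sum_(m.+1 <= l < n.+1) (l%:R `^ (1 + c))^-1
    <= (m%:R `^ (- c) - n%:R `^ (- c)) / c :> R.
  have [nm|mn] := leqP n m.
    by rewrite big_geq ?divr_ge0 ?powR_ge0 ?ltW// (leq_trans nm).
  case: n mn H => // n; rewrite ltnS => mn /(_ (leqW mn)).
  rewrite big_nat_recr//= => H; apply: (le_trans _ (le_trans H _)).
    by rewrite lerDl invr_ge0 powR_ge0.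
  by rewrite ler_pM2r ?invr_gt0// gerBl powR_ge0.
elim: n => [|n IH].
  by rewrite leqn0 => /eqP mE; rewrite mE in m0.
rewrite leq_eqVlt => /predU1P[<-|mn]; first by rewrite big_geq// subrr mul0r.
rewrite big_nat_recr//=; apply: le_trans (lerD (IH mn) (powRN_telescope c0 _)) _.
  exact: leq_trans m0 mn.
by rewrite -mulrDl addrA subrK.
Qed.

(** [zeta] is a [limn], so convergence must come first: the partial sums are bounded by
    [1 + c^-1]. *)
Lemma riemannR_partial_le_zeta c n : 0 < c ->
  \sum_(1 <= l < n) (l%:R `^ (1 + c))^-1 <= zeta (1 + c) :> R.
Proof.
move=> c0; rewrite /zeta.
have c1 : 0 <= 1 + c by rewrite addr_ge0// ltW.
have nd : nondecreasing_seq (series (riemannR (1 + c))).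
  by apply/nondecreasing_seqP => k; rewrite !seriesEnat /= big_nat_recr//= lerDl invr_ge0 powR_ge0.
have ub : cvgn (series (riemannR (1 + c))).
  apply: nondecreasing_is_cvgn => //; exists (1 + c^-1) => _ [k _ <-].
  rewrite seriesEnat /=; case: k => [|k].
    by rewrite big_geq// addr_ge0// invr_ge0 ltW.
  rewrite big_nat_recl//= /riemannR powR1 invr1 lerD2l.
  have := @powRN_tail c 1 k.+2 c0 isT; rewrite powR1 div1r.
  by rewrite big_add1 /= big_add1.
have := nondecreasing_cvgn_le nd ub n.-1.
by apply: le_trans; rewrite seriesEnat /= big_add1.
Qed.

End series_bounds.

(** * Gains summed over the rings around a cell *)

Section gain_sum.
Context {R : realType} (alpha r0 gbar : R) (g : R -> R).
Hypothesis halpha : 2 < alpha.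
Hypothesis hr0 : 0 < r0.
Hypothesis hg : path_loss alpha r0 gbar g.

(* A cell has at most [8 * m] cells at Chebyshev distance [m]. *)
Definition ring_sum (u : R) (q : nat) : R :=
  \sum_(1 <= m < q) (8 * m)%:R * g (m%:R * u).

(** A ring has a number of cells proportional to [m], which turns the exponent [alpha] into
    [alpha - 1], that is [1 + c]. *)
Let c := alpha - 2.
Let c0 : 0 < c. Proof. by rewrite subr_gt0. Qed.

Lemma ring_term (u : R) m : 0 < u -> (0 < m)%N -> r0 <= m%:R * u ->
  (8 * m)%:R * g (m%:R * u) = 8 * u `^ (- alpha) * (m%:R `^ (1 + c))^-1.
Proof.
move=> u0 m0 mu; have [_ _ gE _] := hg.
have mR : 0 < m%:R :> R by rewrite ltr0n.
rewrite gE// powRM ?ltW// natrM.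
have -> : m%:R `^ (- alpha) = m%:R^-1 * (m%:R `^ (1 + c))^-1 :> R.
  rewrite (_ : - alpha = -1 + - (1 + c)); last by rewrite /c; ring.
  rewrite powRD; last by rewrite (gt_eqF mR) implybT.
  by rewrite powR_inv1 ?(ltW mR)// [_ `^ (- (1 + c))]powRN.
move: (_ `^ _) (_ `^ _)^-1 => x y.
by field; rewrite gt_eqF.
Qed.

Lemma ring_sum_far (u : R) q : r0 <= u -> 
  ring_sum u q <= 8 * u `^ (- alpha) * zeta (alpha - 1).
Proof.
move=> ru; have u0 := lt_le_trans hr0 ru.
have -> : alpha - 1 = 1 + c by rewrite /c; ring.
apply: le_trans (ler_wpM2l _ (riemannR_partial_le_zeta q c0)); last first.
  by rewrite mulr_ge0// powR_ge0.
rewrite mulr_sumr /ring_sum big_nat [leRHS]big_nat; apply: ler_sum => m /andP[m1 _].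
have mu : r0 <= m%:R * u by rewrite (le_trans ru)// ler_peMl ?(ltW u0)// ler1n.
by rewrite ring_term.
Qed.

Let near_tail_eq (u : R) : 0 < u ->
  u `^ (- alpha) * ((r0 / u / 2) `^ (- c) / c)
  = (r0 / u) ^+ 2 * (2 `^ (alpha - 2) / ((alpha - 2) * r0 `^ alpha)).
Proof.
move=> u0; have splitp (v : R) : 0 < v -> v `^ alpha = v ^+ 2 * v `^ c.
  move=> v0; rewrite -[in LHS](subrK 2 alpha) addrC powRD ?(gt_eqF v0) ?implybT//.
  by rewrite powR_mulrn// ltW.
rewrite !powRN (splitp u)// (splitp r0)//.
rewrite (powRM _ (ltW (divr_gt0 hr0 u0))) ?invr_ge0// (powRM _ (ltW hr0)) ?invr_ge0 ?(ltW u0)//.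
rewrite -[u^-1](powR_inv1 (ltW u0)) -[2^-1]powR_inv1// !(powRAC _ (-1)) !powR_inv1 ?powR_ge0//.
have uc : 0 < u `^ c by rewrite powR_gt0.
have rc : 0 < r0 `^ c by rewrite powR_gt0.
have tc : 0 < (2 : R) `^ c by rewrite powR_gt0.
rewrite -/c; move: c0 uc rc tc hr0 u0.
move: (u `^ c) (r0 `^ c) (2 `^ c) => x y z c0' x0 y0 z0 r00 u00.
  by field; rewrite !gt_eqF.
by exact: ltW.
Qed.

(** The sum is cut at [m0], the integer part of [r0 / u]. Up to [m0] the gain is at most [gbar], and
    1 + ... + m0 <= m0^2 <= (r0 / u)^2. Beyond, the power law holds and [powRN_tail] applies; [m0]
    is at least half of [r0 / u], whence the power of 2. *)
Lemma ring_sum_near (u : R) q : 0 < u -> u < r0 ->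
  ring_sum u q <= 8 * (r0 / u) ^+ 2 * (gbar + 2 `^ (alpha - 2) / ((alpha - 2) * r0 `^ alpha)).
Proof.
move=> u0 ur; have [g_ge0 gd gE g0] := hg.
pose m0 := Num.truncn (r0 / u).
have ru1 : 1 < r0 / u by rewrite ltr_pdivlMr// mul1r.
have m0_gt0 : (0 < m0)%N by rewrite truncn_gt0 (ltW ru1).
have m0R : 0 < m0%:R :> R by rewrite ltr0n.
have /andP[m0le m0gt] := truncn_itv (ltW (lt_trans ltr01 ru1)).
have gu m : 0 <= g (m%:R * u) by rewrite g_ge0// mulr_ge0// ltW.
have m0half : r0 / u / 2 <= m0%:R.
  rewrite ler_pdivrMr//; apply: ltW; apply: lt_le_trans m0gt _.
  by rewrite -natr1 mulr_natr mulr2n lerD2l ler1n.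
(* Rings are added so that the cut lies inside the range even for small [q]. *)
apply: (@le_trans _ _ (ring_sum u (q + m0.+1))).
  rewrite /ring_sum; have [q1|q1] := leqP q 1.
    by rewrite big_geq//; apply: sumr_ge0 => m _; rewrite mulr_ge0.
  rewrite [leRHS](@big_cat_nat _ _ _ q)/= ?leq_addr// ?(ltnW q1)// lerDl.
  by apply: sumr_ge0 => m _; rewrite mulr_ge0.
rewrite /ring_sum (@big_cat_nat _ _ _ m0.+1)/= ?leq_addl// mulrDr; apply: lerD.
  apply: (@le_trans _ _ (\sum_(1 <= m < m0.+1) (8 * m)%:R * gbar)).
    apply: ler_sum => m _; rewrite ler_wpM2l// (le_trans _ g0)// gd//.
    by rewrite mulr_ge0// ltW.
  rewrite -mulr_suml ler_wpM2r//; first by rewrite (le_trans _ g0)// g_ge0.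
  rewrite -natr_sum -big_distrr /= natrM.
  rewrite ler_pM2l//.
  have sE : (\sum_(1 <= m < m0.+1) m = 'C(m0.+1, 2))%N.
    by rewrite -bin2_sum [RHS]big_ltn// add0n.
  rewrite sE; apply: (@le_trans _ _ (m0%:R ^+ 2)).
    rewrite -natrX ler_nat bin2 /= leq_half_double -mul2n -mulnn.
    by rewrite mulSn mul2n -addnn leqW// leq_add2r leq_pmull.
  by rewrite lerXn2r// ?nnegrE ltW// (lt_trans ltr01).
apply: (@le_trans _ _ (8 * u `^ (- alpha) * (m0%:R `^ (- c) / c))).
  apply: le_trans (ler_wpM2l _ (powRN_tail (q + m0.+1) c0 m0_gt0)); last first.
    by rewrite mulr_ge0// powR_ge0.
  rewrite mulr_sumr big_nat [leRHS]big_nat; apply: ler_sum => m /andP[m1 _].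
  have mu : r0 <= m%:R * u.
    rewrite -ler_pdivrMr//; apply: ltW; apply: lt_le_trans m0gt _.
    by rewrite ler_nat.
  by rewrite ring_term// (leq_ltn_trans _ m1).
have step : m0%:R `^ (- c) <= (r0 / u / 2) `^ (- c).
  rewrite !powRN lef_pV2 ?posrE ?powR_gt0//; last by rewrite divr_gt0// (lt_trans ltr01).
  by apply: ge0_ler_powR; rewrite ?nnegrE ?divr_ge0// ltW.
rewrite -!(mulrA 8) ler_pM2l//.
apply: (@le_trans _ _ (u `^ (- alpha) * ((r0 / u / 2) `^ (- c) / c))).
  by rewrite ler_wpM2l ?powR_ge0// ler_pM2r ?invr_gt0.
rewrite le_eqVlt; apply/orP; left; apply/eqP.
exact: near_tail_eq.
Qed.

End gain_sum.

(** * Chebyshev distance on the grid of cells *)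

(** The absolute difference: at least one of the truncated subtractions is 0. *)
Definition gap (x y : nat) : nat := (x - y) + (y - x).

Definition cheb (q : nat) (a b : 'I_q * 'I_q) : nat :=
  maxn (gap a.1 b.1) (gap a.2 b.2).

Lemma card_gap_le (q : nat) (x : 'I_q) (m : nat) :
  (#|[set y : 'I_q | gap x y <= m]%SET| <= m.*2.+1)%N.
Proof.
rewrite cardE -(size_map (@nat_of_ord q)) -(size_iota (x - m) m.*2.+1).
apply: uniq_leq_size; first by rewrite map_inj_uniq ?enum_uniq//; exact: ord_inj.
move=> y /mapP[z]; rewrite mem_enum inE /gap => zx ->.
rewrite mem_iota -mul2n; lia.
Qed.

Lemma card_gap_eq (q : nat) (x : 'I_q) (m : nat) :
  (#|[set y : 'I_q | gap x y == m]%SET| <= 2)%N.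
Proof.
rewrite cardE -(size_map (@nat_of_ord q)) -[2%N]/(size [:: (x + m)%N; (x - m)%N]).
apply: uniq_leq_size; first by rewrite map_inj_uniq ?enum_uniq//; exact: ord_inj.
move=> y /mapP[z]; rewrite mem_enum inE /gap => /eqP zx ->.
rewrite !inE /=; lia.
Qed.

(** The ring is covered by two full sides of 2m + 1 cells and two sides without corners of 2m - 1
    cells, 8m in all. *)
Lemma card_cheb_eq (q : nat) (a : 'I_q * 'I_q) (m : nat) : (0 < m)%N ->
  (#|[set b | cheb a b == m]%SET| <= 8 * m)%N.
Proof.
move=> m0; pose E (x : 'I_q) := [set y : 'I_q | gap x y == m]%SET.
pose L (x : 'I_q) n := [set y : 'I_q | (gap x y <= n)%N]%SET.
have sub : [set b | cheb a b == m]%SET \subset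
    (finset.setX (E a.1) (L a.2 m) :|: finset.setX (L a.1 m.-1) (E a.2))%SET.
  apply/fintype.subsetP => -[b1 b2]; rewrite finset.in_setU !finset.in_setX !inE /cheb => /eqP /=.
  by clear E L; move: (gap _ _) (gap _ _) => x y; lia.
apply: leq_trans (subset_leq_card sub) _.
apply: leq_trans (leq_card_setU _ _) _; rewrite !cardsX.
have e1 := card_gap_eq a.1 m; have e2 := card_gap_eq a.2 m.
have l1 := card_gap_le a.1 m.-1; have l2 := card_gap_le a.2 m.
apply: (@leq_trans (2 * m.*2.+1 + m.-1.*2.+1 * 2)).
  by apply: leq_add; apply: leq_mul.
by rewrite -!mul2n; lia.
Qed.

Lemma cheb_gt0 (q : nat) (a b : 'I_q * 'I_q) : a != b -> (0 < cheb a b)%N.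
Proof.
case: a b => a1 a2 [b1 b2].
rewrite xpair_eqE negb_and -!(inj_eq (@ord_inj _)) /cheb /gap /=; lia.
Qed.

Lemma cheb_lt (q : nat) (a b : 'I_q * 'I_q) : (cheb a b < q)%N.
Proof.
case: a b => a1 a2 [b1 b2]; rewrite /cheb /gap /=.
have := ltn_ord a1; have := ltn_ord a2; have := ltn_ord b1; have := ltn_ord b2.
lia.
Qed.

(** Cells are grouped by ring: each term becomes a sum over [m] with one index, and the two sums are
    exchanged. *)
Lemma sum_cheb_le (R : realType) (q : nat) (f : nat -> R) (a : 'I_q * 'I_q) :
  (forall m, 0 <= f m) ->
  \sum_(b | a != b) f (cheb a b) <= \sum_(1 <= m < q) (8 * m)%:R * f m.
Proof.
move=> f0.
have chebq b : a != b -> (0 < cheb a b < q)%N by move=> ab; rewrite cheb_gt0// cheb_lt.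
have -> : \sum_(b | a != b) f (cheb a b)
    = \sum_(b | a != b) \sum_(1 <= m < q | m == cheb a b) f m.
  by apply: eq_bigr => b /chebq c0q; rewrite big_nat1_eq c0q.
rewrite (exchange_big_dep predT)//= big_nat [leRHS]big_nat.
apply: ler_sum => m /andP[m1 _]; rewrite sumr_const -[_ *+ #|_|]mulr_natl.
apply: ler_wpM2r => //; rewrite ler_nat.
apply: leq_trans (card_cheb_eq a m1); apply: subset_leq_card.
by apply/fintype.subsetP => b; rewrite !inE => /andP[_ /eqP ->].
Qed.

(** * Distances between nodes of a regular network *)

Section regular_geometry.
Context (R : realType) (k q : nat) (s beta : R) (net : regular_network k q s beta).
Hypothesis s_gt0 : 0 < s.
Hypothesis beta01 : 0 <= beta < 1.

Lemma gapR (x y : nat) : (gap x y)%:R = `|x%:R - y%:R| :> R.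
Proof.
rewrite /gap; have [xy|yx] := leqP x y.
  by rewrite (eqP xy) add0n natrB// distrC ger0_norm// subr_ge0 ler_nat.
rewrite (eqP (ltnW yx)) addn0 natrB; last exact: ltnW.
by rewrite ger0_norm// subr_ge0 ler_nat ltnW.
Qed.

(** Each coordinate varies in an interval of length [beta * s], so a difference of coordinates is
    within [beta * s] of the difference of cell corners. *)
Lemma window_gap (x y : nat) (u v : R) :
  x%:R * s + (1 - beta) * s / 2 <= u <= x%:R * s + (1 + beta) * s / 2 ->
  y%:R * s + (1 - beta) * s / 2 <= v <= y%:R * s + (1 + beta) * s / 2 ->
  ((gap x y)%:R - beta) * s <= `|u - v| <= ((gap x y)%:R + beta) * s.
Proof.
move=> /andP[u1 u2] /andP[v1 v2]; rewrite gapR.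
have xy : `|(u - v) - (x%:R - y%:R) * s| <= beta * s by rewrite ler_norml; apply/andP; split; lra.
have ns : `|(x%:R - y%:R) * s| = `|x%:R - y%:R| * s by rewrite normrM (gtr0_norm s_gt0).
rewrite mulrBl mulrDl -ns; move: xy; set A := (_ - _) * s; set B := u - v => xy.
have h1 : `|B| <= `|A| + `|B - A|.
  by apply: le_trans (ler_normD _ _); rewrite (_ : A + (B - A) = B)//; ring.
have h2 : `|A| <= `|B| + `|B - A|.
  by rewrite -[`|B - A|]normrN; apply: le_trans (ler_normD _ _); rewrite (_ : B + - (B - A) = A)//; ring.
by apply/andP; split; lra.
Qed.

Lemma dist_ge (p p' : R * R) : `|p.1 - p'.1| <= dist p p' /\ `|p.2 - p'.2| <= dist p p'.
Proof.
by split; rewrite -sqrtr_sqr; apply: ler_wsqrtr; rewrite ?lerDl ?lerDr sqr_ge0.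
Qed.

Lemma dist_le (p p' : R * R) (t : R) : `|p.1 - p'.1| <= t -> `|p.2 - p'.2| <= t ->
  dist p p' <= Num.sqrt 2 * t.
Proof.
move=> h1 h2; have t0 : 0 <= t := le_trans (normr_ge0 _) h1.
have -> : Num.sqrt 2 * t = Num.sqrt (2 * t ^+ 2).
  by rewrite sqrtrM// sqrtr_sqr ger0_norm.
apply: ler_wsqrtr; rewrite mulr_natl mulr2n.
by apply: lerD; rewrite -real_normK ?num_real// lerXn2r// nnegrE.
Qed.

(** Distinct nodes have [m >= 1], hence [m - beta >= m * (1 - beta)]. *)
Lemma dist_ge_cheb (i j : 'I_k) : i != j ->
  (cheb (cell net i) (cell net j))%:R * ((1 - beta) * s) <= dist (pos net i) (pos net j).
Proof.
move=> ij; have /andP[b0 b1] := beta01.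
have [w1 w2] := pos_in_window net i; have [w1' w2'] := pos_in_window net j.
have /andP[g1 _] := window_gap w1 w1'; have /andP[g2 _] := window_gap w2 w2'.
have [d1 d2] := dist_ge (pos net i) (pos net j).
have cell_ij : cell net i != cell net j.
  by apply: contra_neq ij => /(bij_inj (cell_bij net)).
set m := cheb _ _; have m1 : 1 <= m%:R :> R.
  by rewrite ler1n cheb_gt0.
apply: (@le_trans _ _ ((m%:R - beta) * s)).
  rewrite mulrA ler_pM2r//; nra.
rewrite /m /cheb; case: leqP => _; [exact: le_trans g2 d2|exact: le_trans g1 d1].
Qed.

Lemma dist_le_gap (i j : 'I_k) (m : nat) :
  (gap (cell net i).1 (cell net j).1 <= m)%N ->
  (gap (cell net i).2 (cell net j).2 <= m)%N ->
  dist (pos net i) (pos net j) <= Num.sqrt 2 * ((m%:R + beta) * s).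
Proof.
move=> h1 h2.
have [w1 w2] := pos_in_window net i; have [w1' w2'] := pos_in_window net j.
have /andP[_ g1] := window_gap w1 w1'; have /andP[_ g2] := window_gap w2 w2'.
by apply: dist_le; [apply: le_trans g1 _|apply: le_trans g2 _];
  rewrite ler_pM2r// lerD2r ler_nat.
Qed.

Lemma sum_gain_le (alpha r0 gbar : R) (g : R -> R) (i : 'I_k) :
  path_loss alpha r0 gbar g ->
  \sum_(j | i != j) gain g net i j <= ring_sum g ((1 - beta) * s) q.
Proof.
move=> [g0 gd _ _]; have /andP[b0 b1] := beta01.
have u0 : 0 <= (1 - beta) * s by rewrite mulr_ge0 ?subr_ge0// ltW.
pose f m := g (m%:R * ((1 - beta) * s)).
apply: (@le_trans _ _ (\sum_(j | i != j) f (cheb (cell net i) (cell net j)))).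
  apply: ler_sum => j ij; apply: gd; first by rewrite mulr_ge0.
  exact: dist_ge_cheb.
have f0 m : 0 <= f m by rewrite g0// mulr_ge0.
apply: le_trans (sum_cheb_le (cell net i) f0).
rewrite [leRHS](reindex (cell net)) /=; last exact/onW_bij/cell_bij.
rewrite le_eqVlt; apply/orP; left; apply/eqP; apply: eq_bigl => j.
by rewrite (inj_eq (bij_inj (cell_bij net))).
Qed.

End regular_geometry.

(** * Flooding *)

Section flooding_theory.
Context (R : realType) (V : finType) (src : V) (G : V -> V -> R) (N0 : R).
Variable F : flood_scheme R.
Hypothesis G_ge0 : forall i j, 0 <= G i j.

Let e := send_energy src F.
Let state t := iter t (flood_slot src G N0 F) (flood_init R src).

Lemma send_energy_ge0 i : 0 <= e i.
Proof. by rewrite /e /send_energy; case: ifP => _; [exact: Eb1_ge0|exact: Eb2_ge0]. Qed.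

(** Decoded but no longer fresh nodes are those that have already transmitted, each exactly once. *)
Lemma flood_invariant t :
  [/\ fresh (state t) \subset decoded (state t),
      forall j, received (state t) j =
        \sum_(i in (decoded (state t) :\: fresh (state t))%SET | i != j) G i j * e i
    & spent (state t) = \sum_(i in (decoded (state t) :\: fresh (state t))%SET) e i].
Proof.
elim: t => [|t [sub rec sp]].
  split => [|j|]; rewrite /= ?finset.setDv ?big_set0//.
  by rewrite big_pred0// => i; rewrite inE.
rewrite /state iterS -/(state t); set S := state t in sub rec sp *.
rewrite /flood_slot /=; set dec := (decoded S :|: _)%SET.
have decS : decoded S \subset dec by exact: finset.subsetUl.
(* Every node that knew the message before the slot has transmitted by its end. *)
have old : (dec :\: (dec :\: decoded S))%SET = decoded S.
  by rewrite finset.setDDr finset.setDv finset.set0U; exact/finset.setIidPr.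
have freshI : (decoded S :&: fresh S)%SET = fresh S by exact/finset.setIidPr.
rewrite old; split => [|j|]; first exact: finset.subsetDl.
- by rewrite rec [RHS](big_setIDcond _ _ (fresh S)) /= freshI addrC.
- by rewrite sp [RHS](big_setID (fresh S)) /= freshI addrC.
Qed.

Lemma flood_energy_le : flood_energy src G N0 F <= Eb1 F + #|V|.-1%:R * Eb2 F.
Proof.
rewrite /flood_energy /flood_run -/(state _).
have [_ _ ->] := flood_invariant (slots F).
apply: (@le_trans _ _ (\sum_i e i)).
  rewrite big_mkcond; apply: ler_sum => i _; case: ifP => // _.
  exact: send_energy_ge0.
rewrite (bigD1 src)//= {1}/e /send_energy eqxx lerD2l.
rewrite (eq_bigr (fun=> Eb2 F)); last first.
  by move=> i isrc; rewrite /e /send_energy (negbTE isrc).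
rewrite sumr_const -[_ *+ #|_|]mulr_natl.
have -> : #|(fun i : V => i != src)| = #|V|.-1 by rewrite -(cardC1 src).
by [].
Qed.

(** After [t] slots all nodes of rank below [t] have decoded. Nodes that decode earlier than their
    rank do no harm, since energy accumulates: only an upper bound on the time at which the members
    of [A] transmit is needed. *)
Lemma flood_reach (rank : V -> nat) :
  (forall j, (rank j < slots F)%N) ->
  (forall j, j != src -> exists2 A : {set V},
     forall i, i \in A -> i != j /\ (i = src \/ (rank i < rank j)%N) &
     N0 * ln 2 < \sum_(i in A) G i j * e i) ->
  reaches_all src G N0 F.
Proof.
move=> rankF step.
have main t j : j = src \/ (rank j < t)%N -> j \in decoded (state t).
  elim: t j => [|t IH] j.
    by case=> [->|//]; rewrite /= inE.
  rewrite /state iterS -/(state t) /flood_slot /= => jt.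
  rewrite finset.in_setU; apply/orP.
  have [jsrc|jsrc] := eqVneq j src; first by left; apply: IH; left.
  have {}jt : (rank j <= t)%N by case: jt => // /eqP; rewrite (negbTE jsrc).
  right; rewrite inE; have [A rkA] := step j jsrc; move=> /lt_le_trans; apply.
  have [sub rec _] := flood_invariant t; rewrite rec.
  set S := state t in IH sub *.
  have freshI : (decoded S :&: fresh S)%SET = fresh S by exact/finset.setIidPr.
  rewrite addrC -[in X in X + _]freshI.
  rewrite -big_setIDcond big_mkcond [leRHS]big_mkcond.
  apply: ler_sum => i _; case: ifPn => [iA|_].
    have [ij isr] := rkA _ iA; rewrite ij IH//.
    by case: isr => [|h]; [left|right; exact: leq_trans h jt].
  by case: ifP => // _; rewrite mulr_ge0// send_energy_ge0.
apply/setP => j; rewrite finset.in_setT /flood_run -/(state _).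
by apply: main; right.
Qed.

End flooding_theory.

(** * Flooding by blocks of cells *)

Section grid_flooding.
Context (R : realType) (k q : nat) (s beta : R).
Hypothesis s_gt0 : 0 < s.
Hypothesis beta01 : 0 <= beta < 1.

Lemma card_interval_ge (x b : nat) : (x + b <= q)%N ->
  (b <= #|[set z : 'I_q | x <= z < x + b]%SET|)%N.
Proof.
move=> xbq; rewrite cardE -(size_map (@nat_of_ord q)) -[leqLHS](size_iota x).
apply: uniq_leq_size; first exact: iota_uniq.
move=> y; rewrite mem_iota => /andP[xy yx].
have yq : (y < q)%N by exact: leq_trans yx xbq.
by apply/mapP; exists (Ordinal yq); rewrite // mem_enum inE /= xy.
Qed.

(* Every node whose cell has both coordinates below [b] hears the source
   directly; any other node hears a full b x b block of nodes of smaller rank. *)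
Lemma grid_reach (net : regular_network k q s beta) (g : R -> R) (N0 D : R)
    (b : nat) (F : flood_scheme R) :
  (forall r, 0 <= r -> 0 <= g r) ->
  (forall r r', 0 <= r -> r <= r' -> g r' <= g r) ->
  (0 < b)%N -> Num.sqrt 2 * (b%:R * s) <= D ->
  N0 * ln 2 < g D * Eb1 F -> Eb2 F <= Eb1 F ->
  (q <= b)%N \/ (Num.sqrt 2 * ((2 * b)%:R * s) <= D /\
     N0 * ln 2 < (b ^ 2)%:R * (g D * Eb2 F)) ->
  (2 * q < slots F)%N ->
  reaches_all (source net) (gain g net) N0 F.
Proof.
move=> g0 gd b0 bD src_ok E21 far sl; have /andP[be0 be1] := beta01.
have D0 : 0 <= D by apply: le_trans bD; rewrite mulr_ge0// mulr_ge0// ltW.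
(* With truncated subtraction, the rank is 0 exactly on the b x b block at the origin. *)
pose rk (j : 'I_k) := ((cell net j).1.+1 - b + ((cell net j).2.+1 - b))%N.
have G0 i j : 0 <= gain g net i j by rewrite g0// sqrtr_ge0.
have near i j : dist (pos net i) (pos net j) <= D -> g D <= gain g net i j.
  by move=> ?; apply: gd => //; exact: sqrtr_ge0.
have sq2 : 0 <= Num.sqrt 2 :> R by exact: sqrtr_ge0.
apply: (flood_reach G0 (rank := rk)).
  move=> j; apply: leq_ltn_trans sl; rewrite /rk.
  have := ltn_ord (cell net j).1; have := ltn_ord (cell net j).2.
  by move: (nat_of_ord _) (nat_of_ord _) => x y; clear; lia.
move=> j jsrc; have [jb|jb] := boolP (((cell net j).1 < b) && ((cell net j).2 < b))%N.
  exists [set source net]%SET.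
    by move=> i; rewrite inE => /eqP ->; split; [rewrite eq_sym|left].
  rewrite big_set1 {1}/send_energy eqxx; apply: lt_le_trans src_ok _.
  apply: ler_wpM2r; first exact: Eb1_ge0.
  apply: near; apply: le_trans bD.
  have [s1 s2] := source_in_origin net.
  (* Inside the block the coordinates of cells differ by at most [b.-1], and [beta < 1] makes up the
     missing unit. *)
  apply: (@le_trans _ _ (Num.sqrt 2 * ((b.-1%:R + beta) * s))).
    move/andP: jb => [j1 j2]; apply: dist_le_gap => //; rewrite ?s1 ?s2 /gap;
      by move: (nat_of_ord _) j1 j2 => x; clear; lia.
  apply: ler_wpM2l => //; rewrite ler_pM2r// -[in leRHS](prednK b0) -natr1.
  by rewrite lerD2l ltW.
have jb' : ((b <= (cell net j).1) || (b <= (cell net j).2))%N.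
  by move: jb; rewrite negb_and -!leqNgt.
have bq : (b < q)%N.
  by case/orP: jb' => h; apply: leq_ltn_trans h _; exact: ltn_ord.
case: far => [|[D2 blk]]; first by rewrite leqNgt bq.
pose x := (cell net j).1; pose y := (cell net j).2.
(* The [b] indices just before [z], or the first [b] ones if [z < b]. The block thus stays in the
   grid; as some coordinate of [j] is at least [b], the rank strictly drops. *)
pose I (z : nat) := [set t : 'I_q | (z - b <= t < z - b + b)%N]%SET.
pose A := [set i | cell net i \in finset.setX (I x) (I y)]%SET.
have memA i : i \in A -> ((x - b <= (cell net i).1 < x - b + b) &&
                          (y - b <= (cell net i).2 < y - b + b))%N.
  by rewrite inE; case: (cell net i) => i1 i2; rewrite finset.in_setX !inE.
have cA : (b ^ 2 <= #|A|)%N.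
  have -> : A = (cell net @^-1: finset.setX (I x) (I y))%SET by apply/setP => i; rewrite !inE.
  rewrite on_card_preimset; last exact/onW_bij/cell_bij.
  rewrite cardsX expnS expn1; apply: leq_mul; apply: card_interval_ge.
    by have := ltn_ord x; move: (nat_of_ord x) bq => z; clear; lia.
  by have := ltn_ord y; move: (nat_of_ord y) bq => z; clear; lia.
have rkA i : i \in A -> (rk i < rk j)%N.
  move=> /memA; rewrite /rk -/x -/y; move: jb' b0; rewrite -/x -/y.
  move: (nat_of_ord x) (nat_of_ord y) (nat_of_ord (cell net i).1) (nat_of_ord (cell net i).2).
  by move=> z1 z2 z3 z4; clear; lia.
exists A.
  move=> i iA; have := rkA i iA; split; last by right.
  by apply: contraTneq (rkA i iA) => ->; rewrite ltnn.
apply: lt_le_trans blk _.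
apply: (@le_trans _ _ (\sum_(i in A) g D * Eb2 F)).
  rewrite sumr_const -[_ *+ #|_|]mulr_natl; apply: ler_wpM2r.
    by rewrite mulr_ge0 ?g0// Eb2_ge0.
  by rewrite ler_nat.
apply: ler_sum => i iA; apply: ler_pM.
- exact: g0.
- exact: Eb2_ge0.
- apply: near; apply: le_trans D2.
  apply: (@le_trans _ _ (Num.sqrt 2 * ((b%:R + beta) * s))).
    have := memA i iA; rewrite -/x -/y => h.
    apply: dist_le_gap => //; rewrite /gap -/x -/y; move: h b0;
    move: (nat_of_ord x) (nat_of_ord y) (nat_of_ord (cell net i).1) (nat_of_ord (cell net i).2);
    by move=> z1 z2 z3 z4; clear; lia.
  apply: ler_wpM2l => //; rewrite ler_pM2r// mul2n -addnn natrD lerD2l.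
  by apply: le_trans (ltW be1) _; rewrite ler1n.
- by rewrite /send_energy; case: ifP.
Qed.

(** [D] is the range and [sh] the energy of a relay relative to the source. Decoding needs a strict
    excess over the threshold, so energies carry the factor 1 + 1/(l + 1) and the bound is reached
    as an infimum. The schemes are fixed before the network. *)
Lemma exists_flooding (g : R -> R) (N0 D sh : R) (b : nat) :
  (forall r, 0 <= r -> 0 <= g r) ->
  (forall r r', 0 <= r -> r <= r' -> g r' <= g r) ->
  0 < N0 -> 0 < g D -> 0 <= sh <= 1 ->
  (0 < b)%N -> Num.sqrt 2 * (b%:R * s) <= D ->
  (q <= b)%N \/ (Num.sqrt 2 * ((2 * b)%:R * s) <= D /\ 1 <= (b ^ 2)%:R * sh) ->
  exists F : nat -> flood_scheme R, forall net : regular_network k q s beta,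
    (forall l, reaches_all (source net) (gain g net) N0 (F l)) /\
    (Eb_flood (source net) (gain g net) N0 F <=
      (N0 * ln 2 / g D * (1 + k.-1%:R * sh))%:E)%E.
Proof.
move=> g0 gd N00 gD /andP[sh0 sh1] b0 bD far.
have ln20 : 0 < ln 2 :> R by rewrite ln_gt0// ltr1n.
pose base := N0 * ln 2 / g D.
have base0 : 0 < base by rewrite divr_gt0// mulr_gt0.
pose e (l : nat) := base * (1 + l.+1%:R^-1).
have e0 l : 0 <= e l by rewrite mulr_ge0 ?addr_ge0 ?invr_ge0// ltW.
have she0 l : 0 <= sh * e l by rewrite mulr_ge0.
have ge l : N0 * ln 2 < g D * e l.
  have -> : g D * e l = N0 * ln 2 * (1 + l.+1%:R^-1).
    by rewrite /e /base; move: (1 + _) => y; field; rewrite gt_eqF.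
  by rewrite ltr_pMr ?mulr_gt0// ltrDl invr_gt0.
exists (fun l => FloodScheme (2 * q).+1 (e0 l) (she0 l)) => net.
have G0 i j : 0 <= gain g net i j by rewrite g0// sqrtr_ge0.
split=> [l|].
  apply: (@grid_reach net g N0 D b) => //=.
    by rewrite ler_piMl.
  case: far => [|[D2 bsh]]; [by left|right; split => //].
  apply: lt_le_trans (ge l) _.
  rewrite (_ : _ * (g D * _) = (g D * e l) * ((b ^ 2)%:R * sh)); last by ring.
  by apply: ler_peMr => //; apply: mulr_ge0 => //; exact: ltW.
apply/lee_addgt0Pr => d d0.
pose X := base * (1 + k.-1%:R * sh).
have X0 : 0 <= X by rewrite mulr_ge0 ?(ltW base0)// addr_ge0// mulr_ge0.
(* This index makes the excess [X / l.+1%:R] at most [d]. *)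
pose l := Num.truncn (X / d).
apply: (@le_trans _ _ (flood_energy (source net) (gain g net) N0
    (FloodScheme (2 * q).+1 (e0 l) (she0 l)))%:E).
  by apply: ereal_inf_lbound; exists l.
rewrite -EFinD lee_fin; apply: le_trans (flood_energy_le _ _ _ _) _.
rewrite /= card_ord.
have -> : e l + k.-1%:R * (sh * e l) = X + X / l.+1%:R by rewrite /e /X; ring.
rewrite lerD2l ler_pdivrMr// mulrC -ler_pdivrMr//.
by apply: ltW; exact: truncnS_gt.
Qed.

End grid_flooding.

(** * Converse bounds on the grid and comparison with flooding *)

Section assembly.
Context {R : realType}.

(** The ranges of multi-hop flooding contain the factor 2 sqrt(2); this is the source of the power
    [3 * alpha / 2] of 2. *)
Lemma powR_sqrt8 (a : R) : (Num.sqrt 2 * 2) `^ a = 2 `^ (3 * a / 2) :> R.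
Proof.
have -> : Num.sqrt 2 * 2 = 2 `^ (3 / 2) :> R.
  rewrite (_ : 3 / 2 = 2^-1 + 1); last by field.
  by rewrite powRD ?pnatr_eq0 ?implybT// powR12_sqrt// powRr1.
by rewrite -powRrM; congr (_ `^ _); field.
Qed.

Lemma zeta_ge1 (c : R) : 0 < c -> 1 <= zeta (1 + c).
Proof.
move=> c0; apply: le_trans (riemannR_partial_le_zeta 2 c0).
by rewrite big_nat1 powR1 invr1.
Qed.

Context (k q : nat) (s beta : R) (net : regular_network k q s beta).
Context (alpha r0 gbar : R) (g : R -> R) (N0 : R).
Hypothesis s_gt0 : 0 < s.
Hypothesis beta01 : 0 <= beta < 1.
Hypothesis q_gt1 : (1 < q)%N.
Hypothesis kE : k = (q ^ 2)%N.
Hypothesis N0_gt0 : 0 < N0.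
Hypothesis hg : path_loss alpha r0 gbar g.
Context d (T : measurableType d) (P : probability T R) (ch : channel (gain g net) N0 P).

Let gain_ge0 i j : 0 <= gain g net i j.
Proof. by have [g0 _ _ _] := hg; rewrite g0// sqrtr_ge0. Qed.

(** [Eb_min_ge] with all nodes but the source as receivers. *)
Lemma Eb_min_ge_ring_sum (Gmax : R) : 0 < Gmax -> ring_sum g ((1 - beta) * s) q <= Gmax ->
  ((k.-1%:R * (N0 * ln 2) / Gmax)%:E <= Eb_min (source net) ch)%E.
Proof.
move=> G0 GS.
have -> : k.-1 = #|[set~ source net]%SET| by rewrite cardsC1 card_ord.
apply: Eb_min_ge => //; first by rewrite !inE eqxx.
move=> i; apply: le_trans GS; apply: le_trans (@sum_gain_le _ _ _ _ _ net s_gt0 beta01 _ _ _ _ i hg).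
by rewrite big_mkcondl; apply: ler_sum => j _; case: ifP.
Qed.

(** [Eb_min_ge] with a single receiver, which exists because [k > 1]. *)
Lemma Eb_min_ge_gbar : 0 < gbar ->
  ((N0 * ln 2 / gbar)%:E <= Eb_min (source net) ch)%E.
Proof.
move=> gbar0; have [g0 gd _ gb] := hg.
have /card_gt0P[j] : (0 < #|[set~ source net]%SET|)%N.
  by rewrite cardsC1 card_ord kE -subn1 subn_gt0 (@leq_trans (1 ^ 2).+1)// ltn_exp2r.
rewrite !inE => jsrc.
have -> : N0 * ln 2 / gbar = #|[set j]%SET|%:R * (N0 * ln 2) / gbar by rewrite cards1 mul1r.
apply: Eb_min_ge => //; first by rewrite inE eq_sym.
move=> i; rewrite big_mkcondr big_set1; case: ifP => _; last exact: ltW.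
by apply: le_trans gb; apply: gd => //; exact: sqrtr_ge0.
Qed.

End assembly.

Theorem theorem4 (R : realType) (beta alpha r0 gbar : R)
    (hbeta : 0 <= beta < 1) (halpha : 2 < alpha) (hr0 : 0 < r0) (hgbar : 0 < gbar) :
  exists c1 : R,
    c1 <= Num.max
            (2 `^ (3 * alpha / 2 + 4) * zeta (alpha - 1) / (1 - beta) `^ alpha)
            (Num.max
               ((2 * r0) `^ alpha * gbar)
               (2 `^ (3 * alpha / 2 + 3) * r0 `^ alpha / (1 - beta) `^ (alpha + 2)
                * (gbar + 2 `^ (alpha - 2) / ((alpha - 2) * r0 `^ alpha))
                * (1 + 4 * (1 - beta) ^+ 2))) /\
    forall (k q : nat) (s N0 : R) (g : R -> R),
      (1 < q)%N -> k = (q ^ 2)%N -> 0 < s -> 0 < N0 -> path_loss alpha r0 gbar g ->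
      exists F : nat -> flood_scheme R,
        forall net : regular_network k q s beta,
          (forall l : nat, reaches_all (source net) (gain g net) N0 (F l)) /\
          (forall (d : measure_display) (T : measurableType d) (P : probability T R)
             (ch : channel (gain g net) N0 P),
             (Eb_flood (source net) (gain g net) N0 F
              <= c1%:E * Eb_min (source net) ch)%E).
Proof.
set T1 := _ * zeta _ / _; set T2 := _ * gbar; set K := gbar + _; set T3 := _ * (1 + _).
exists (Num.max T1 (Num.max T2 T3)); split=> // k q s N0 g q1 kE s0 N00 hg.
have [g_ge0 gd gE g0b] := hg; have /andP[b0 b1] := hbeta.
set v := 1 - beta in T1 T3 *.
have v0 : 0 < v by rewrite subr_gt0.
have v1 : v <= 1 by rewrite gerBl.
have ln20 : 0 < ln 2 :> R by rewrite ln_gt0// ltr1n.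
have sq2 : 1 <= Num.sqrt 2 :> R by rewrite -[leLHS]sqrtr1 ler_wsqrtr// ler1n.
have sq0 : 0 <= Num.sqrt 2 :> R by exact: sqrtr_ge0.
have sq22 : 1 <= Num.sqrt 2 * 2 :> R.
  by apply: le_trans sq2 _; rewrite ler_peMr// ler1n.
have k4 : (1 < k)%N by rewrite kE (@leq_trans (1 ^ 2).+1)// ltn_exp2r.
have kR : 1 <= k.-1%:R :> R by rewrite ler1n -subn1 subn_gt0.
have kS : k%:R = 1 + k.-1%:R :> R by rewrite nat1r prednK// ltnW.
have T2_gt0 : 0 < T2 by rewrite mulr_gt0// powR_gt0// mulr_gt0.
set c1 := Num.max _ _.
have c1T1 : T1 <= c1 by rewrite le_max lexx.
have c1T2 : T2 <= c1 by rewrite le_max [X in _ || X]le_max lexx orbT.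
have c1T3 : T3 <= c1 by rewrite le_max [X in _ || X]le_max lexx !orbT.
have c1_gt0 : 0 < c1 by exact: lt_le_trans c1T2.
have gpow r : r0 <= r -> g r = (r `^ alpha)^-1 by move=> /gE ->; rewrite powRN.
(* Common end of the three regimes. In units of [N0 * ln 2], flooding costs at most [D] to the power
   [alpha] times [1 + (k - 1) * sh], and [LB] is a lower bound on [Eb_min]. *)
have finish (D sh : R) (b : nat) (LB : R) : r0 <= D -> 0 <= sh <= 1 -> (0 < b)%N ->
    Num.sqrt 2 * (b%:R * s) <= D ->
    (q <= b)%N \/ (Num.sqrt 2 * ((2 * b)%:R * s) <= D /\ 1 <= (b ^ 2)%:R * sh) ->
    D `^ alpha * (1 + k.-1%:R * sh) <= c1 * LB ->
    (forall (net : regular_network k q s beta) d (T : measurableType d)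
       (P : probability T R) (ch : channel (gain g net) N0 P),
       ((LB * (N0 * ln 2))%:E <= Eb_min (source net) ch)%E) ->
    exists F : nat -> flood_scheme R,
        forall net : regular_network k q s beta,
          (forall l : nat, reaches_all (source net) (gain g net) N0 (F l)) /\
          (forall (d : measure_display) (T : measurableType d) (P : probability T R)
             (ch : channel (gain g net) N0 P),
             (Eb_flood (source net) (gain g net) N0 F
              <= c1%:E * Eb_min (source net) ch)%E).
  move=> rD sh01 bb bD far ineq lower.
  have D_gt0 : 0 < D by exact: lt_le_trans rD.
  have gD : g D = (D `^ alpha)^-1 by exact: gpow.
  have gD0 : 0 < g D by rewrite gD invr_gt0 powR_gt0.
  have [F hF] := exists_flooding k s0 hbeta g_ge0 gd N00 gD0 sh01 bb bD far.
  exists F => net; have [reach Ebf] := hF net; split=> // d T P ch.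
  apply: le_trans Ebf _.
  apply: (@le_trans _ _ (c1%:E * (LB * (N0 * ln 2))%:E)%E); last first.
    by apply: lee_wpmul2l; [rewrite lee_fin ltW|exact: lower].
  rewrite -EFinM lee_fin gD invrK.
  rewrite (_ : _ * _ * _ = D `^ alpha * (1 + k.-1%:R * sh) * (N0 * ln 2)); last by ring.
  by rewrite [leRHS]mulrA ler_pM2r// mulr_gt0.
have [ru|ur] := leP r0 (v * s).
- pose Z := zeta (alpha - 1).
  have Z1 : 1 <= Z by rewrite /Z (_ : alpha - 1 = 1 + (alpha - 2)) ?zeta_ge1 ?subr_gt0//; ring.
  have Z0 : 0 < Z := lt_le_trans ltr01 Z1.
  pose Gm := 8 * (v * s) `^ (- alpha) * Z.
  have vs0 : 0 < v * s by rewrite mulr_gt0.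
  have Gm0 : 0 < Gm by rewrite !mulr_gt0// powR_gt0.
  apply: (finish (Num.sqrt 2 * (2 * s)) 1 1%N (k.-1%:R / Gm)) => //.
  + apply: le_trans ru _; apply: (@le_trans _ _ s); first by rewrite ler_piMl// ltW.
    by rewrite mulrA ler_peMl// ltW.
  + by rewrite ler01 lexx.
  + by apply: ler_wpM2l => //; apply: ler_wpM2r; [exact: ltW|rewrite ler1n].
  + by right; rewrite muln1 mulr1; split.
  (* The factor 16 in [T1] is the 8 of the ring bound times the 2 of [k <= 2 * (k - 1)]. *)
  + rewrite mulr1 -kS mulrA powRM ?mulr_ge0 ?(ltW s0) // powR_sqrt8.
    rewrite [c1 * _]mulrA ler_pdivlMr//; apply: (@le_trans _ _ (T1 * k.-1%:R)); last by rewrite ler_wpM2r.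
    rewrite /T1 /Gm powRN powRM ?(ltW v0) ?(ltW s0)// powRD; last by rewrite pnatr_eq0 implybT.
    have -> : 2 `^ 4 = 16 :> R by rewrite powR_mulrn//; ring.
    have va : 0 < v `^ alpha by rewrite powR_gt0.
    have sa : 0 < s `^ alpha by rewrite powR_gt0.
    rewrite -/Z; set W := 2 `^ _; have W0 : 0 < W by rewrite powR_gt0.
    rewrite [leLHS](_ : _ = 8 * (W * Z / v `^ alpha) * k%:R); last by field; rewrite !gt_eqF.
    rewrite [leRHS](_ : _ = 8 * (W * Z / v `^ alpha) * (2 * k.-1%:R)); last by field; rewrite gt_eqF.
    apply: ler_wpM2l; first by rewrite !mulr_ge0 ?invr_ge0 ?(ltW Z0) ?(ltW W0) ?(ltW va).
    by rewrite kS mulr_natl mulr2n lerD2r.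
  + move=> net d T P ch; rewrite mulrAC.
    apply: (Eb_min_ge_ring_sum (alpha := alpha) (r0 := r0) (gbar := gbar)) => //.
    exact: (ring_sum_far halpha hr0 hg q ru).
have vs0 : 0 < v * s by rewrite mulr_gt0.
have [ks|ks] := ltP (k.-1%:R * s ^+ 2) (r0 ^+ 2).
(* The relays are silent: the source reaches the whole grid, seen as one block of side [q]. *)
- apply: (finish (2 * r0) 0 q (gbar^-1)) => //.
  + by rewrite mulr_natl mulr2n lerDl ltW.
  + by rewrite lexx ler01.
  + exact: ltnW.
  (* Squared, this is 2 k s^2 <= 4 r0^2, which follows from k <= 2 (k - 1) and (k - 1) s^2 <
     r0^2. *)
  + rewrite -(@ler_pXn2r _ 2)// ?nnegrE ?mulr_ge0 ?(ltW s0) ?(ltW hr0) ?sqrtr_ge0//.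
    rewrite !exprMn sqr_sqrtr// -natrX -kE kS.
    have : s ^+ 2 <= k.-1%:R * s ^+ 2 by rewrite ler_peMl// sqr_ge0.
    by move: ks; move: (s ^+ 2) (r0 ^+ 2) (k.-1%:R) => x y z; nra.
  + by left.
  + by rewrite mulr0 addr0 mulr1 ler_pdivlMr.
  + by move=> net d T P ch; rewrite mulrC; exact: (Eb_min_ge_gbar (alpha := alpha) (r0 := r0)).
pose b := Num.truncn (r0 / (v * s)).
have rvs : 1 < r0 / (v * s) by rewrite ltr_pdivlMr// mul1r.
have bb : (0 < b)%N by rewrite truncn_gt0 (ltW rvs).
have bR : 0 < b%:R :> R by rewrite ltr0n.
have /andP[ble bgt] := truncn_itv (ltW (lt_trans ltr01 rvs)).
have bhalf : r0 / (v * s) <= 2 * b%:R.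
  by apply: ltW; apply: lt_le_trans bgt _; rewrite -natr1 mulr_natl mulr2n lerD2l ler1n.
have K0 : 0 < K.
  by rewrite addr_gt0// divr_gt0 ?powR_gt0// mulr_gt0 ?powR_gt0// subr_gt0.
pose Gm := 8 * (r0 / (v * s)) ^+ 2 * K.
have Gm0 : 0 < Gm by rewrite mulr_gt0// mulr_gt0// exprn_gt0// divr_gt0.
have bs : b%:R * s <= r0 / v.
  by rewrite -ler_pdivlMr// -mulrA -invfM.
have D2 : Num.sqrt 2 * ((2 * b)%:R * s) <= Num.sqrt 2 * (2 * (r0 / v)).
  by rewrite ler_wpM2l ?sqrtr_ge0// natrM -mulrA ler_wpM2l.
have b2 : 0 < (b ^ 2)%:R :> R by rewrite ltr0n expn_gt0 bb.
apply: (finish (Num.sqrt 2 * (2 * (r0 / v))) ((b ^ 2)%:R^-1) b (k.-1%:R / Gm)) => //.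
- have rv : r0 <= r0 / v by rewrite ler_pdivlMr// ler_piMr// ltW.
  apply: le_trans rv _; rewrite [leRHS]mulrA ler_peMl//.
  by rewrite divr_ge0// ltW.
- by rewrite invr_ge0 ltW//= invf_le1// ler1n expn_gt0 bb.
- apply: le_trans D2; rewrite ler_wpM2l ?sqrtr_ge0// ler_pM2r// ler_nat.
  by rewrite leq_pmull.
- by right; split => //; rewrite divff// gt_eqF.
- rewrite (mulrA (Num.sqrt 2)) (powRM _ (le_trans ler01 sq22) (divr_ge0 (ltW hr0) (ltW v0))) powR_sqrt8.
  rewrite [c1 * _]mulrA ler_pdivlMr//; apply: (@le_trans _ _ (T3 * k.-1%:R)); last by rewrite ler_wpM2r.
  have -> : (r0 / v) `^ alpha = r0 `^ alpha / v `^ alpha.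
    rewrite powRM ?invr_ge0 ?(ltW hr0) ?(ltW v0)// -[v^-1](powR_inv1 (ltW v0)).
    by rewrite powRAC powR_inv1 ?powR_ge0.
  rewrite /T3 /Gm [2 `^ (_ + 3)]powRD; last by rewrite pnatr_eq0 implybT.
  rewrite [v `^ (_ + 2)]powRD; last by rewrite (gt_eqF v0) implybT.
  have -> : 2 `^ 3 = 8 :> R by rewrite powR_mulrn//; ring.
  rewrite (powR_mulrn 2 (ltW v0)).
  have va : 0 < v `^ alpha by rewrite powR_gt0.
  have ra : 0 < r0 `^ alpha by rewrite powR_gt0.
  set W := 2 `^ _; have W0 : 0 < W by rewrite powR_gt0.
  (* [r1] bounds the source's share of the cost, by the lower bound on the network size, and [r2]
     that of the relays, by [bhalf]. They give the summands 1 and [4 * v ^+ 2] of the last factor of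
     [T3]. *)
  have r1 : r0 ^+ 2 / s ^+ 2 <= k.-1%:R by rewrite ler_pdivrMr ?exprn_gt0.
  have r2 : r0 ^+ 2 / s ^+ 2 / b%:R ^+ 2 <= 4 * v ^+ 2.
    rewrite ler_pdivrMr ?exprn_gt0//.
    have : (r0 / (v * s)) ^+ 2 <= (2 * b%:R) ^+ 2.
      by rewrite ler_pXn2r// nnegrE ?(ltW (lt_trans ltr01 rvs))// mulr_ge0.
    rewrite -(ler_pM2l (exprn_gt0 2 v0)) => h; apply: le_trans (le_trans h _).
      by rewrite le_eqVlt; apply/orP; left; apply/eqP; field; rewrite !gt_eqF.
    by rewrite le_eqVlt; apply/orP; left; apply/eqP; ring.
  pose C := W * r0 `^ alpha / v `^ alpha * 8 * K / v ^+ 2.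
  have C0 : 0 <= C.
    by rewrite /C !mulr_ge0 ?invr_ge0 ?exprn_ge0 ?(ltW W0) ?(ltW ra) ?(ltW va) ?(ltW K0) ?(ltW v0).
  rewrite [leLHS](_ : _ = C * (r0 ^+ 2 / s ^+ 2 * (1 + k.-1%:R / b%:R ^+ 2))); last first.
    by rewrite /C natrX; field; rewrite !gt_eqF.
  rewrite [leRHS](_ : _ = C * ((1 + 4 * v ^+ 2) * k.-1%:R)); last first.
    by rewrite /C; field; rewrite !gt_eqF.
  apply: ler_wpM2l => //.
  rewrite mulrDr mulr1 mulrDl mul1r; apply: lerD => //.
  by rewrite [leLHS]mulrA [leLHS]mulrAC; apply: ler_wpM2r.
- move=> net d T P ch; rewrite mulrAC.
  apply: (Eb_min_ge_ring_sum (alpha := alpha) (r0 := r0) (gbar := gbar)) => //.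
  exact: (ring_sum_near halpha hr0 hg q vs0 ur).
Qed.
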